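(* Let $\alpha\in(0,1)$, let $T(G_n) = N_m(n) - n\,p_m(\delta_0)$, and define the test $$\psi(G_n) = \mathbf 1\left\{|T(G_n)|\ge m\sqrt{8n\log(2/\alpha)}\right\}.$$ The type-I error of this test is asymptotically bounded by $\alpha$: as $n\to\infty$, $$\mathbb P_0(\psi(G_n)\ne 0)\le (1+o(1))\,\alpha .$$ Furthermore, the type-II error satisfies, as $n\to\infty$, $$\mathbb P_1(\psi(G_n)=0)\le o(1)\qquad\text{when }\gamma>\tfrac12,$$ $$\mathbb P_1(\psi(G_n)=0)\le (2+o(1))\exp\left(-\left(\left(\frac{c\,|1-p_m(\delta_0)/p_m(\delta_1)|}{m\sqrt 8}-\sqrt{\log(2/\alpha)}\right)\vee 0\right)^2\right)\qquad\text{when }\gamma=\tfrac12,$$ and $$\mathbb P_1(\psi(G_n)=0)\ge (1+o(1))(1-\alpha)\qquad\text{when }\gamma<\tfrac12 .$$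
   Context: Model. Fix an integer $m\ge1$ and a function $\delta:\mathbb N\to(-m,\infty)$. A random sequence of undirected loopless graphs $(G_t)_{t\ge1}$ (multiple edges allowed, degrees counted with multiplicity) is built as follows. $G_1$ has vertices $v_0,v_1$ joined by $m$ edges. For $t\ge2$, $G_{t,0}$ is $G_{t-1}$ plus an isolated vertex $v_t$; for $i=1,\dots,m$, given $G_{t,i-1}$, a vertex $v_{t,i}\in\{v_0,\dots,v_{t-1}\}$ is sampled with $\mathbb P(v_{t,i}=v\mid G_{t,i-1})=\frac{D_v(G_{t,i-1})+\delta(t)}{\sum_{j=0}^{t-1}(D_{v_j}(G_{t,i-1})+\delta(t))}$, where $D_v(G)$ is the degree of $v$ in $G$, and $G_{t,i}$ is $G_{t,i-1}$ plus the edge $\{v_{t,i},v_t\}$; finally $G_t=G_{t,m}$. Vertices are identified with $[n]=\{0,1,\dots,n\}$, $D_v(t)=D_v(G_t)$, and $N_k(t)=\#\{v\in[t]:D_v(t)=k\}$. Null model (probability $\mathbb P_0$, expectation $\mathbb E_0$): $\delta(t)=\delta_0$ for all $t$, where $\delta_0>-m$. Alternative model (probability $\mathbb P_1$, expectation $\mathbb E_1$): $\delta(t)=\delta_0$ for $t\le\tau_n$ and $\delta(t)=\delta_1$ for $t>\tau_n$, where $\delta_0,\delta_1>-m$, $\delta_0\neq\delta_1$, and $\tau_n=n-cn^\gamma$ (rounded down to an integer) with $c>0$, $\gamma\in(0,1)$. The constants $m,\delta_0,\delta_1,c,\gamma$ are fixed as $n\to\infty$. The parameter $\delta_0$ is known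 to the test. Moreover, $p_m(\delta)=\dfrac{2+\delta/m}{m+\delta+2+\delta/m}$ for $\delta>-m$, and $x\vee y=\max(x,y)$. *)

(* Defs.v *)
From HB Require Import structures.
From mathcomp Require Import all_boot all_order all_algebra.
From mathcomp Require Import all_classical all_reals all_analysis.

Set Implicit Arguments.
Unset Strict Implicit.
Unset Printing Implicit Defensive.

Import Order.TTheory GRing.Theory Num.Theory.
Import numFieldNormedType.Exports.

Local Open Scope classical_set_scope.
Local Open Scope ring_scope.

(* An undirected loopless multigraph on the vertices 0, ..., t is encoded by
   its symmetric matrix of edge multiplicities, of type 'M[nat]_t.+1.
   Symmetry and the absence of loops are not part of the type: they hold by
   construction for every graph of the process below. *)

Definition init_graph (m : nat) : 'M[nat]_2 :=
  \matrix_(i, j) (if i == j then 0%N else m).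

(* The new vertex is ord_max; the vertices 0, ..., t of the old graph are the
   lift ord_max u, which have the same value as u. *)
Definition add_vertex (t : nat) (A : 'M[nat]_t.+1) : 'M[nat]_t.+2 :=
  \matrix_(i, j) (if (unlift ord_max i, unlift ord_max j) is (Some a, Some b)
                  then A a b else 0%N).

Definition add_edge (t : nat) (A : 'M[nat]_t.+2) (u : 'I_t.+1) :
    'M[nat]_t.+2 :=
  A + delta_mx (lift ord_max u) ord_max + delta_mx ord_max (lift ord_max u).

Definition degree (t : nat) (A : 'M[nat]_t.+1) (v : 'I_t.+1) : nat :=
  (\sum_(w < t.+1) A v w)%N.

Definition num_deg (k t : nat) (A : 'M[nat]_t.+1) : nat :=
  #|[set v : 'I_t.+1 | degree A v == k]%SET|.

(* G t i is G_{t,i}, with G t m = G_t.  The index of v is shifted by one: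
   v t i is v_{t+1,i}, which ranges over the vertices 0, ..., t. *)
Definition graph_process (Omega : Type) (m : nat)
    (v : forall t : nat, nat -> Omega -> 'I_t.+1)
    (G : forall t : nat, nat -> Omega -> 'M[nat]_t.+1) : Prop :=
  [/\ forall w, G 1%N m w = init_graph m,
      forall t w, (1 <= t)%N -> G t.+1 0%N w = add_vertex (G t m w) &
      forall t i w, (1 <= t)%N -> (1 <= i <= m)%N ->
        G t.+1 i w = add_edge (G t.+1 i.-1 w) (v t i w)].

Definition attach_prob (R : realType) (delta : R) (t : nat)
    (A : 'M[nat]_t.+2) (u : 'I_t.+1) : R :=
  ((degree A (lift ord_max u))%:R + delta) /
  \sum_(j < t.+1) ((degree A (lift ord_max j))%:R + delta).

Definition cond_prob (d : measure_display) (Omega : measurableType d)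
    (R : realType) (P : probability Omega R) (A B : set Omega) : R :=
  fine (P (A `&` B)) / fine (P B).

(* The conditional law of v_{t,i} given G_{t,i-1}, for t >= 2, with t shifted
   by one as above.  There are countably many graphs, so conditioning on the
   atoms of positive probability is all there is. *)
Definition attachment_law (d : measure_display) (Omega : measurableType d)
    (R : realType) (m : nat)
    (v : forall t : nat, nat -> Omega -> 'I_t.+1)
    (G : forall t : nat, nat -> Omega -> 'M[nat]_t.+1)
    (delta : nat -> R) (P : probability Omega R) : Prop :=
  forall (t i : nat) (A : 'M[nat]_t.+2) (u : 'I_t.+1),
    (1 <= t)%N -> (1 <= i <= m)%N ->
    P [set w | G t.+1 i.-1 w = A] != 0%E ->
    cond_prob P [set w | v t i w = u] [set w | G t.+1 i.-1 w = A]
      = attach_prob (delta t.+1) A u.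

Definition change_time (R : realType) (c gamma : R) (n : nat) : int :=
  Num.floor (n%:R - c * n%:R `^ gamma).

Definition delta_alt (R : realType) (delta0 delta1 c gamma : R) (n : nat) :
    nat -> R :=
  fun t => if t%:Z <= change_time c gamma n then delta0 else delta1.

Definition p_m (R : realType) (m : nat) (delta : R) : R :=
  (2 + delta / m%:R) / (m%:R + delta + 2 + delta / m%:R).

Definition stat (R : realType) (m : nat) (delta0 : R) (n : nat)
    (A : 'M[nat]_n.+1) : R :=
  (num_deg m A)%:R - n%:R * p_m m delta0.

Definition test (R : realType) (m : nat) (delta0 alpha : R) (n : nat)
    (A : 'M[nat]_n.+1) : nat :=
  if m%:R * Num.sqrt (8 * n%:R * ln (2 / alpha)) <= `|stat m delta0 A|
  then 1%N else 0%N.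

(* Main.v *)
(* The number K of old vertices of degree m is a Markov chain: given the graph,
   an edge of vertex t lowers K by one with probability q K, where q =
   (m + delta(t)) / (total weight) is deterministic, and the arrival of v_t adds
   one.  Hence K minus its mean has moment generating function at l bounded by
   exp (l^2/2) per edge for |l| <= 1/2: conditioning replaces l by (1 - q) l.
   This yields P(|N_m(n) - E N_m(n)| >= x) <= 2 exp (- x^2/(2mn)) for x <= mn/2,
   whose exponent is at least four times the one in the theorem; the slack
   absorbs all the lower order terms, so that every o(1) but the one for
   gamma > 1/2 can be taken to be 0.  The mean solves an explicit linear
   recursion whose fixed slope is p_m, which gives
   E_1 N_m(n) - n p_m(delta0) ~ (n - tau_n) (1 - p_m(delta0) / p_m(delta1)). *)

Require Import Defs.
From HB Require Import structures.
From mathcomp Require Import all_boot all_order all_algebra.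
From mathcomp Require Import all_classical all_reals all_analysis.
From mathcomp Require Import ring lra.

Set Implicit Arguments.
Unset Strict Implicit.
Unset Printing Implicit Defensive.

Import Order.TTheory GRing.Theory Num.Theory.
Import numFieldNormedType.Exports.

Local Open Scope classical_set_scope.
Local Open Scope ring_scope.

(** * Finite-valued random variables: real-valued probabilities and expectations as finite sums *)

Definition pr (d : measure_display) (Omega : measurableType d) (R : realType)
    (P : probability Omega R) (B : set Omega) : R := fine (P B).

(** The expectation of [f X] when [L] lists every value of [X] exactly once; hence the hypotheses
    [uniq L] and [X w \in L] that accompany it below. *)
Definition fexp (d : measure_display) (Omega : measurableType d)
    (R : realType) (P : probability Omega R) (T : eqType) (X : Omega -> T)
    (L : seq T) (f : T -> R) : R :=
  \sum_(x <- L) pr P [set w | X w = x] * f x.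

Lemma pr_ge0 (d : measure_display) (Omega : measurableType d) (R : realType)
    (P : probability Omega R) (B : set Omega) : 0 <= pr P B.
Proof. by rewrite /pr fine_ge0. Qed.

Lemma prE (d : measure_display) (Omega : measurableType d) (R : realType)
    (P : probability Omega R) (B : set Omega) :
  measurable B -> P B = (pr P B)%:E.
Proof. by move=> mB; rewrite /pr fineK// fin_num_measure. Qed.

Lemma pr_le (d : measure_display) (Omega : measurableType d) (R : realType)
    (P : probability Omega R) (A B : set Omega) :
  measurable A -> measurable B -> A `<=` B -> pr P A <= pr P B.
Proof.
move=> mA mB AB; rewrite -lee_fin -!prE//.
by apply: le_measure => //; rewrite inE.
Qed.

Lemma prU_le (d : measure_display) (Omega : measurableType d) (R : realType)
    (P : probability Omega R) (A B : set Omega) :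
  measurable A -> measurable B -> pr P (A `|` B) <= pr P A + pr P B.
Proof.
move=> mA mB; rewrite -lee_fin EFinD -!prE//; last exact: measurableU.
exact: measureU2.
Qed.

Lemma pr_setC (d : measure_display) (Omega : measurableType d) (R : realType)
    (P : probability Omega R) (A : set Omega) :
  measurable A -> pr P (~` A) = 1 - pr P A.
Proof.
move=> mA; apply: EFin_inj; rewrite -prE; last exact: measurableC.
by rewrite probability_setC// EFinB -prE.
Qed.

Lemma pr_disjU (d : measure_display) (Omega : measurableType d) (R : realType)
    (P : probability Omega R) (A B : set Omega) :
  measurable A -> measurable B -> A `&` B = set0 ->
  pr P (A `|` B) = pr P A + pr P B.
Proof.
move=> mA mB AB; apply: EFin_inj; rewrite EFinD -!prE//; last exact: measurableU.
exact: measureU.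
Qed.

Lemma measurable_preim_seq (d : measure_display) (Omega : measurableType d)
    (T : eqType) (X : Omega -> T) (L : seq T) :
  (forall x, measurable [set w | X w = x]) ->
  measurable [set w | X w \in L].
Proof.
move=> mX; elim: L => [|x L IH].
  by rewrite (_ : [set _ | _] = set0)//; apply/seteqP; split.
rewrite (_ : [set _ | _] = [set w | X w = x] `|` [set w | X w \in L]).
  exact: measurableU.
apply/seteqP; split=> w /=; rewrite inE; first by move=> /orP[/eqP|]; auto.
by case=> [->|->]; rewrite ?eqxx ?orbT.
Qed.

Lemma pr_split (d : measure_display) (Omega : measurableType d) (R : realType)
    (P : probability Omega R) (T : eqType) (X : Omega -> T) (L : seq T)
    (B : set Omega) :
  (forall x, measurable [set w | X w = x]) -> measurable B -> uniq L ->
  pr P (B `&` [set w | X w \in L])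
    = \sum_(x <- L) pr P (B `&` [set w | X w = x]).
Proof.
move=> mX mB; elim: L => [|x L IH] /=.
  move=> _; rewrite big_nil (_ : _ `&` _ = set0) ?/pr ?measure0//.
  by apply/seteqP; split=> w //= [].
move=> /andP[xL uL]; rewrite big_cons -IH// -pr_disjU.
- congr (pr P _); apply/seteqP; split=> w /=; rewrite inE.
    by move=> [Bw /orP[/eqP|]]; [left|right].
  by move=> [[Bw ->]|[Bw ->]]; rewrite ?eqxx ?orbT.
- exact: measurableI.
- apply: measurableI => //; exact: measurable_preim_seq.
- apply/seteqP; split=> w //= [[_ Xx] [_]]; rewrite Xx => xL'.
  by rewrite xL' in xL.
Qed.

Lemma pr_total (d : measure_display) (Omega : measurableType d) (R : realType)
    (P : probability Omega R) (T : eqType) (X : Omega -> T) (L : seq T)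
    (B : set Omega) :
  (forall x, measurable [set w | X w = x]) -> measurable B -> uniq L ->
  (forall w, X w \in L) ->
  pr P B = \sum_(x <- L) pr P (B `&` [set w | X w = x]).
Proof.
move=> mX mB uL XL; rewrite -pr_split//; congr (pr P _).
by apply/seteqP; split=> w //= [].
Qed.

Lemma measurable_preim (d : measure_display) (Omega : measurableType d)
    (T : eqType) (X : Omega -> T) (L : seq T) (Q : pred T) :
  (forall x, measurable [set w | X w = x]) -> (forall w, X w \in L) ->
  measurable [set w | Q (X w)].
Proof.
move=> mX XL; rewrite (_ : [set _ | _] = [set w | X w \in [seq x <- L | Q x]]).
  exact: measurable_preim_seq.
by apply/seteqP; split=> w /=; rewrite mem_filter XL andbT.
Qed.

Lemma fexp_indic (d : measure_display) (Omega : measurableType d)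
    (R : realType) (P : probability Omega R) (T : eqType) (X : Omega -> T)
    (L : seq T) (Q : pred T) :
  (forall x, measurable [set w | X w = x]) -> uniq L ->
  (forall w, X w \in L) ->
  pr P [set w | Q (X w)] = fexp P X L (fun x => (Q x)%:R).
Proof.
move=> mX uL XL; rewrite (pr_total P mX _ uL XL); last exact: measurable_preim XL.
apply: eq_bigr => x _; case Qx: (Q x); rewrite ?mulr1 ?mulr0.
  congr (pr P _); apply/seteqP; split=> w //= [] //.
  by move=> Xx; rewrite Xx.
rewrite (_ : _ `&` _ = set0) ?/pr ?measure0//.
by apply/seteqP; split=> w //= [+ Xx]; rewrite Xx Qx.
Qed.

Lemma fexp_le (d : measure_display) (Omega : measurableType d) (R : realType)
    (P : probability Omega R) (T : eqType) (X : Omega -> T) (L : seq T)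
    (f g : T -> R) :
  (forall x, f x <= g x) -> fexp P X L f <= fexp P X L g.
Proof. by move=> fg; apply: ler_sum => x _; rewrite ler_wpM2l// pr_ge0. Qed.

(** Splitting the event [Y = y] according to the pair of values of [X] and [V], only the cells with
    [y = phi x u] survive. In the process, [X] is the graph before an edge is drawn and [V] the
    sampled endpoint. *)
Lemma fexp_comp2 (d : measure_display) (Omega : measurableType d)
    (R : realType) (P : probability Omega R) (T T' : eqType) (U : finType)
    (X : Omega -> T) (V : Omega -> U) (Y : Omega -> T') (phi : T -> U -> T')
    (L : seq T) (L' : seq T') (g : T' -> R) :
  (forall x, measurable [set w | X w = x]) ->
  (forall u, measurable [set w | V w = u]) ->
  (forall y, measurable [set w | Y w = y]) ->
  (forall w, Y w = phi (X w) (V w)) ->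
  uniq L -> uniq L' -> (forall w, X w \in L) -> (forall w, Y w \in L') ->
  fexp P Y L' g
    = \sum_(x <- L) \sum_(u : U)
        pr P ([set w | V w = u] `&` [set w | X w = x]) * g (phi x u).
Proof.
move=> mX mV mY YE uL uL' XL YL'.
transitivity (\sum_(y <- L') \sum_(x <- L) \sum_(u : U)
    pr P (([set w | V w = u] `&` [set w | X w = x]) `&` [set w | Y w = y])
      * g y).
  apply: eq_bigr => y _; rewrite (pr_total P mX (mY y) uL XL) mulr_suml.
  apply: eq_bigr => x _.
  rewrite (pr_total P mV _ (index_enum_uniq U)); last 2 first.
  - exact: measurableI.
  - by move=> w; rewrite mem_index_enum.
  rewrite mulr_suml; apply: eq_bigr => u _; congr (pr P _ * _).
  by apply/seteqP; split=> w /=; tauto.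
rewrite exchange_big; apply: eq_bigr => x _ /=.
rewrite exchange_big; apply: eq_bigr => u _ /=.
have mVX : measurable ([set w | V w = u] `&` [set w | X w = x]).
  exact: measurableI.
rewrite (pr_total P mY mVX uL' YL') mulr_suml; apply: eq_bigr => y _.
have [->//|ny] := eqVneq y (phi x u).
rewrite (_ : _ `&` [set w | Y w = y] = set0) ?/pr ?measure0 ?mul0r//.
apply/seteqP; split=> w //= [[Vu Xx] Yy].
by move: ny; rewrite -Yy YE Vu Xx eqxx.
Qed.

Lemma fexp_comp (d : measure_display) (Omega : measurableType d)
    (R : realType) (P : probability Omega R) (T T' : eqType)
    (X : Omega -> T) (Y : Omega -> T') (phi : T -> T')
    (L : seq T) (L' : seq T') (g : T' -> R) :
  (forall x, measurable [set w | X w = x]) ->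
  (forall y, measurable [set w | Y w = y]) ->
  (forall w, Y w = phi (X w)) ->
  uniq L -> uniq L' -> (forall w, X w \in L) -> (forall w, Y w \in L') ->
  fexp P Y L' g = fexp P X L (g \o phi).
Proof.
move=> mX mY YE uL uL' XL YL'.
have mV (u : unit) : measurable [set w : Omega | tt = u].
  case: u; rewrite (_ : [set _ | _] = setT)//.
  by apply/seteqP; split.
rewrite (fexp_comp2 P (V := fun=> tt) (phi := fun x _ => phi x) _ mX mV mY YE
  uL uL' XL YL').
apply: eq_bigr => x _; rewrite (bigD1 tt)//= big1 ?addr0//.
by congr (pr P _ * _); apply/seteqP; split=> w /=; tauto.
Qed.

(** * Effect of vertex and edge insertion on degrees and on the count of vertices of degree [m] *)

(** The newest vertex [ord_max] is left out: its degree is still growing while its edges are drawn,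
    and it enters the count only once they are all there. *)
Definition num_old_deg (k t : nat) (A : 'M[nat]_t.+2) : nat :=
  #|[set u : 'I_t.+1 | degree A (lift ord_max u) == k]%SET|.

Lemma degree_add_vertex_old (t : nat) (A : 'M[nat]_t.+1) (u : 'I_t.+1) :
  degree (add_vertex A) (lift ord_max u) = degree A u.
Proof.
rewrite /degree big_ord_recr /= mxE !unlift_none liftK addn0.
apply: eq_bigr => w _; rewrite mxE liftK.
by rewrite (_ : widen_ord _ w = lift ord_max w) ?liftK//; apply: val_inj;
  rewrite /= /bump leqNgt ltn_ord.
Qed.

Lemma degree_add_vertex_new (t : nat) (A : 'M[nat]_t.+1) :
  degree (add_vertex A) ord_max = 0%N.
Proof. by rewrite /degree big1// => w _; rewrite mxE unlift_none. Qed.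

Lemma degree_add_edge_old (t : nat) (A : 'M[nat]_t.+2) (u j : 'I_t.+1) :
  degree (add_edge A u) (lift ord_max j)
    = (degree A (lift ord_max j) + (u == j))%N.
Proof.
rewrite /degree [in RHS](bigD1 ord_max)//= (bigD1 ord_max)//= /add_edge !mxE.
rewrite !eqxx (inj_eq lift_inj) !andbT eq_sym [X in (_ + X)%R](_ : _ = 0%N).
  rewrite addr0 /=; set b := (u == j); rewrite (eq_bigr (fun i => A (lift ord_max j) i)).
    by rewrite natrDE natn addnAC.
  move=> i im; rewrite !mxE (negPf im) andbF.
  by rewrite (eq_sym (lift _ _)) (negPf (neq_lift _ _)) !addr0.
by rewrite (eq_sym (lift _ _)) (negPf (neq_lift _ _)).
Qed.

Lemma degree_add_edge_new (t : nat) (A : 'M[nat]_t.+2) (u : 'I_t.+1) :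
  degree (add_edge A u) ord_max = (degree A ord_max).+1.
Proof.
rewrite /degree [in RHS](bigD1 (lift ord_max u))//= (bigD1 (lift ord_max u))//=.
rewrite /add_edge !mxE !eqxx (negPf (neq_lift _ _)) /= addr0.
rewrite (eq_bigr (fun i => A ord_max i)); first by rewrite natrDE natn addnAC addn1.
by move=> i iu; rewrite !mxE (negPf iu) (negPf (neq_lift _ _)) andbF /= !addr0.
Qed.

Lemma num_deg_old (k t : nat) (A : 'M[nat]_t.+2) :
  num_deg k A = (num_old_deg k A + (degree A ord_max == k))%N.
Proof.
rewrite /num_deg /num_old_deg -!sum1_card !big_mkcond big_ord_recr /= !inE.
congr (_ + _)%N; rewrite [RHS]big_mkcond /=.
apply: eq_bigr => u _; rewrite !inE (_ : widen_ord _ u = lift ord_max u)//.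
by apply: val_inj; rewrite /= /bump leqNgt ltn_ord.
Qed.

Lemma num_old_deg_add_vertex (k t : nat) (A : 'M[nat]_t.+1) :
  num_old_deg k (add_vertex A) = num_deg k A.
Proof.
by apply: eq_card => u; rewrite !inE degree_add_vertex_old.
Qed.

(** Degrees only grow and start at [m] or above, so no vertex can enter the class of degree [m]; the
    endpoint [u] leaves it if it was there. The additive form avoids truncated subtraction. *)
Lemma num_old_deg_add_edge (m t : nat) (A : 'M[nat]_t.+2) (u : 'I_t.+1) :
  (forall j, m <= degree A (lift ord_max j))%N ->
  num_old_deg m A
    = ((degree A (lift ord_max u) == m) + num_old_deg m (add_edge A u))%N.
Proof.
move=> dA; rewrite /num_old_deg (cardsD1 u) inE; congr (_ + _)%N.
apply: eq_card => j; rewrite !inE degree_add_edge_old.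
have [<-|_] := eqVneq u j; last by rewrite addn0.
by rewrite /= eqn_leq addn1 ltnNge dA.
Qed.

(* The state after [i] of the [m] edges of vertex [t.+1] have been drawn. *)
Definition attach_inv (m t i : nat) (A : 'M[nat]_t.+2) : Prop :=
  [/\ forall u, (m <= degree A (lift ord_max u))%N,
      (\sum_(u < t.+1) degree A (lift ord_max u))%N = (2 * m * t + i)%N &
      degree A ord_max = i].

Definition full_inv (m t : nat) (A : 'M[nat]_t.+1) : Prop :=
  (forall u, m <= degree A u)%N /\
  (\sum_(u < t.+1) degree A u)%N = (2 * m * t)%N.

Lemma full_inv_init (m : nat) : full_inv m (init_graph m).
Proof.
have deg u : degree (init_graph m) u = m.
  rewrite /degree !big_ord_recl big_ord0 /= !mxE.
  by case: u => [[|[|]]] //= *; rewrite ?addn0.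
split=> [u|]; first by rewrite deg.
by rewrite (eq_bigr _ (fun u _ => deg u)) sum_nat_const card_ord muln1.
Qed.

Lemma attach_inv0 (m t : nat) (A : 'M[nat]_t.+1) :
  full_inv m A -> attach_inv m 0 (add_vertex A).
Proof.
move=> [dA sA]; split.
- by move=> u; rewrite degree_add_vertex_old.
- by under eq_bigr do rewrite degree_add_vertex_old; rewrite sA addn0.
- exact: degree_add_vertex_new.
Qed.

Lemma attach_invS (m t i : nat) (A : 'M[nat]_t.+2) (u : 'I_t.+1) :
  attach_inv m i A -> attach_inv m i.+1 (add_edge A u).
Proof.
move=> [dA sA nA]; split.
- by move=> j; rewrite degree_add_edge_old (leq_trans (dA j))// leq_addr.
- under eq_bigr do rewrite degree_add_edge_old.
  rewrite big_split /= sA addnS -[RHS]addn1; congr (_ + _)%N.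
  by rewrite (bigD1 u)//= eqxx big1 ?addn0// => j ju; rewrite eq_sym (negPf ju).
- by rewrite degree_add_edge_new nA.
Qed.

(** The old vertices carry [2 * m * t + m] and the completed new vertex another [m], which makes
    [2 * m * t.+1]. *)
Lemma attach_inv_full (m t : nat) (A : 'M[nat]_t.+2) :
  attach_inv m m A -> full_inv m A.
Proof.
move=> [dA sA nA]; split=> [u|].
  by case: (unliftP ord_max u) => [j ->|->]; rewrite ?nA.
rewrite big_ord_recr /= nA (eq_bigr (fun u => degree A (lift ord_max u))).
  by rewrite sA -addnA addnn -[m.*2]mul2n mulnS addnC.
move=> u _; congr (degree A _).
by apply: val_inj; rewrite /= /bump leqNgt ltn_ord.
Qed.

(** * Moment generating function of a single attachment *)

(** The exponential is at most [1 / (1 - y)], and [(1 - y) * (1 + y + 2 * y ^+ 2) = 1 + y ^+ 2 * (1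
    - 2 * y)] is at least 1. *)
Lemma expR_le_quadratic (R : realType) (y : R) :
  y <= 1 / 2 -> expR y <= 1 + y + 2 * y ^+ 2.
Proof.
move=> y2; have y1 : 0 < 1 - y by lra.
have e1 : 1 - y <= expR (- y) by exact: expR_ge1Dx.
rewrite -[expR y]invrK -expRN.
apply: (@le_trans _ _ (1 - y)^-1).
  by rewrite lef_pV2// posrE expR_gt0.
rewrite -div1r ler_pdivrMr//.
have : 0 <= y ^+ 2 * (1 - 2 * y) by rewrite mulr_ge0 ?sqr_ge0//; lra.
lra.
Qed.

(** The variable is centred, so the linear terms of the quadratic bound cancel. The quadratic ones
    add up to [2 * l ^+ 2 * p * (1 - p)], which is at most [l ^+ 2 / 2] because [(1 - 2 * p) ^+ 2]
    is nonnegative. *)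
Lemma bernoulli_mgf (R : realType) (p l : R) :
  0 <= p <= 1 -> `|l| <= 1 / 2 ->
  (1 - p) * expR (l * p) + p * expR (l * (p - 1)) <= expR (l ^+ 2 / 2).
Proof.
move=> /andP[p0 p1]; rewrite ler_norml => /andP[l0 l1].
have b1 : l * p <= 1 / 2 by nra.
have b2 : l * (p - 1) <= 1 / 2 by nra.
have := ler_wpM2l p0 (expR_le_quadratic b2).
have p1' : 0 <= 1 - p by lra.
have := ler_wpM2l p1' (expR_le_quadratic b1).
have := expR_ge1Dx (l ^+ 2 / 2).
have : 0 <= l ^+ 2 * (1 - 2 * p) ^+ 2 by rewrite mulr_ge0 ?sqr_ge0.
lra.
Qed.

(** The probability that a given old vertex of degree [m] receives the next edge of vertex [t.+1],
    when [i] edges of it have already been drawn. *)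
Definition attach_rate (R : realType) (m : nat) (delta : R) (t i : nat) : R :=
  (m%:R + delta) / ((2 * m * t + i)%:R + t.+1%:R * delta).

(** Since [delta] may be negative, it is grouped with one [m] per vertex; [t.+1 * m <= 2 * m * t] as
    soon as [t] is positive. *)
Lemma attach_weight_ge (R : realType) (m t i : nat) (delta : R) :
  - m%:R < delta -> (0 < t)%N ->
  t.+1%:R * (m%:R + delta) <= (2 * m * t + i)%:R + t.+1%:R * delta.
Proof.
move=> d0 t0; rewrite mulrDr lerD2r -natrM ler_nat.
by rewrite mulSn (leq_trans _ (leq_addr _ _))// -mulnA mul2n -addnn
  [(t * m)%N]mulnC leq_add2r leq_pmulr.
Qed.

Lemma attach_weight_gt0 (R : realType) (m t i : nat) (delta : R) :
  - m%:R < delta -> (0 < t)%N ->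
  0 < (2 * m * t + i)%:R + t.+1%:R * delta.
Proof.
move=> d0 t0; apply: lt_le_trans (attach_weight_ge _ d0 t0).
by rewrite mulr_gt0// ?ltr0n//; lra.
Qed.

Lemma attach_rate_ge0 (R : realType) (m t i : nat) (delta : R) :
  - m%:R < delta -> (0 < t)%N -> 0 <= attach_rate m delta t i.
Proof.
move=> d0 t0; rewrite divr_ge0//; first lra.
exact/ltW/attach_weight_gt0.
Qed.

(** The factor [t.+1] matters twice: it makes the rate times the count a probability, and it bounds
    the error that a step adds to the mean. *)
Lemma attach_rate_le (R : realType) (m t i : nat) (delta : R) :
  - m%:R < delta -> (0 < t)%N -> t.+1%:R * attach_rate m delta t i <= 1.
Proof.
move=> d0 t0; rewrite mulrA ler_pdivrMr ?mul1r; last exact: attach_weight_gt0.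
exact: attach_weight_ge.
Qed.

Lemma attach_rate_le1 (R : realType) (m t i : nat) (delta : R) :
  - m%:R < delta -> (0 < t)%N -> attach_rate m delta t i <= 1.
Proof.
move=> d0 t0; apply: le_trans (attach_rate_le i d0 t0).
by rewrite ler_peMl ?attach_rate_ge0// ler1n.
Qed.

Lemma attach_weightE (R : realType) (m t i : nat) (delta : R)
    (A : 'M[nat]_t.+2) : attach_inv m i A ->
  \sum_(j < t.+1) ((degree A (lift ord_max j))%:R + delta)
    = (2 * m * t + i)%:R + t.+1%:R * delta.
Proof.
move=> [_ sA _]; rewrite big_split /= -natr_sum sA; congr (_ + _).
by rewrite sumr_const card_ord mulr_natl.
Qed.

Lemma sum_attach_prob (R : realType) (m t i : nat) (delta : R)
    (A : 'M[nat]_t.+2) : - m%:R < delta -> (0 < t)%N -> attach_inv m i A ->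
  \sum_(u < t.+1) attach_prob delta A u = 1.
Proof.
move=> d0 t0 iA; rewrite /attach_prob -mulr_suml divff//.
by rewrite (attach_weightE _ iA) gt_eqF// attach_weight_gt0.
Qed.

Lemma sum_attach_prob_deg (R : realType) (m t i : nat) (delta : R)
    (A : 'M[nat]_t.+2) : attach_inv m i A ->
  \sum_(u < t.+1) attach_prob delta A u
      * (degree A (lift ord_max u) == m)%:R
    = attach_rate m delta t i * (num_old_deg m A)%:R.
Proof.
move=> iA; rewrite /num_old_deg -sum1_card natr_sum mulr_sumr [RHS]big_mkcond.
apply: eq_bigr => u _; rewrite inE /attach_prob /attach_rate (attach_weightE _ iA).
by case: eqP => [->|_]; rewrite ?mulr1 ?mulr0.
Qed.

(* The conditional mean of the new count is [(1 - rate) * old count], and the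
   count drops by at most one. *)
Lemma attach_step_mgf (R : realType) (m t i : nat) (delta mu l : R)
    (A : 'M[nat]_t.+2) :
  - m%:R < delta -> (0 < t)%N -> attach_inv m i A -> `|l| <= 1 / 2 ->
  \sum_(u < t.+1) attach_prob delta A u
    * expR (l * ((num_old_deg m (add_edge A u))%:R
                 - (1 - attach_rate m delta t i) * mu))
  <= expR (l ^+ 2 / 2)
     * expR ((1 - attach_rate m delta t i) * l * ((num_old_deg m A)%:R - mu)).
Proof.
move=> d0 t0 iA l12; set q := attach_rate _ _ _ _; set K := num_old_deg m A.
pose p := q * K%:R; pose b u : R := (degree A (lift ord_max u) == m)%:R.
(* The centred new count is [(1 - q) * (K - mu) + (p - b u)]. As [b u] is 0 or 1,
   [expR (l * (p - b u))] is affine in [b u], and averaging over [u] leaves the centred Bernoulli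
   variable of parameter [p]. *)
rewrite (eq_bigr (fun u => expR ((1 - q) * l * (K%:R - mu)) *
  (attach_prob delta A u * expR (l * p)
   + attach_prob delta A u * b u * (expR (l * (p - 1)) - expR (l * p))))).
  rewrite -mulr_sumr big_split /=.
  rewrite -(mulr_suml _ _ _ (expR (l * p))) -(mulr_suml _ _ _ (_ - _)) (sum_attach_prob d0 t0 iA).
  rewrite (sum_attach_prob_deg _ iA) -/q -/K -/p mulrC ler_wpM2r ?expR_ge0//.
  rewrite (_ : _ + _ = (1 - p) * expR (l * p) + p * expR (l * (p - 1))).
    apply: bernoulli_mgf => //; rewrite mulr_ge0 ?attach_rate_ge0//=.
    apply: le_trans (attach_rate_le i d0 t0); rewrite /p mulrC.
    rewrite ler_wpM2r ?attach_rate_ge0// ler_nat.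
    by rewrite (leq_trans (max_card _))// card_ord.
  by ring.
move=> u _; have [dA _ _] := iA.
have -> : (num_old_deg m (add_edge A u))%:R = K%:R - b u :> R.
  by rewrite /K (num_old_deg_add_edge u dA) natrD addrAC subrr add0r.
rewrite [expR _](_ : _ = expR ((1 - q) * l * (K%:R - mu)) * expR (l * (p - b u))).
  rewrite mulrCA; congr (_ * _); rewrite /b.
  by case: (_ == m); rewrite /= ?mulr1n ?mulr0n ?subr0; ring.
by rewrite -expRD; congr expR; rewrite /p; ring.
Qed.

(** * Propagation of the moment bound along the process *)

(** The range is required to be finite, not just countable, so that [fexp] applies. *)
Definition discrete (d : measure_display) (Omega : measurableType d)
    (T : eqType) (X : Omega -> T) : Prop :=
  (exists2 L : seq T, uniq L & forall w, X w \in L) /\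
  (forall x, measurable [set w | X w = x]).

Lemma discrete_comp2 (d : measure_display) (Omega : measurableType d)
    (T T' : eqType) (U : finType) (X : Omega -> T) (V : Omega -> U)
    (Y : Omega -> T') (phi : T -> U -> T') :
  discrete X -> (forall u, measurable [set w | V w = u]) ->
  (forall w, Y w = phi (X w) (V w)) -> discrete Y.
Proof.
move=> [[L uL XL] mX] mV YE; split.
  exists (undup [seq phi x u | x <- L, u <- enum U]); first exact: undup_uniq.
  by move=> w; rewrite mem_undup YE; apply: allpairs_f => //; rewrite mem_enum.
move=> y; pose Z w := (X w, V w).
rewrite (_ : [set w | Y w = y] = [set w | [pred z | phi z.1 z.2 == y] (Z w)]).
  apply: (@measurable_preim _ _ _ _ [seq (x, u) | x <- L, u <- enum U]).
    move=> [x u]; rewrite (_ : [set _ | _] = [set w | X w = x] `&` [set w | V w = u]).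
      exact: measurableI.
    by apply/seteqP; split=> w; rewrite /Z /= => -[-> ->].
  by move=> w; apply: allpairs_f => //; rewrite mem_enum.
by apply/seteqP; split=> w /=; rewrite YE => /eqP.
Qed.

Lemma discrete_comp (d : measure_display) (Omega : measurableType d)
    (T T' : eqType) (X : Omega -> T) (Y : Omega -> T') (phi : T -> T') :
  discrete X -> (forall w, Y w = phi (X w)) -> discrete Y.
Proof.
move=> dX YE; apply: (discrete_comp2 (V := fun=> tt) (phi := fun x _ => phi x) dX _ YE).
case; rewrite (_ : [set _ | _] = setT)//.
by apply/seteqP; split.
Qed.

(** A sub-Gaussian bound with centre [mu] and variance proxy [sg], restricted to small [l]. It is
    asked for every listing [L] of the values, so that no particular one has to be carried through
    the induction. *)
Definition mgf_bound (d : measure_display) (Omega : measurableType d)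
    (R : realType) (P : probability Omega R) (T : eqType) (X : Omega -> T)
    (K : T -> nat) (mu sg : R) : Prop :=
  forall (L : seq T) (l : R), uniq L -> (forall w, X w \in L) ->
    `|l| <= 1 / 2 ->
    fexp P X L (fun x => expR (l * ((K x)%:R - mu))) <= expR (l ^+ 2 * sg / 2).

(** One edge turns the proxy [sg] into [(1 - q) ^+ 2 * sg + 1], which is at most [sg + 1]. The
    induction hypothesis is applied at [(1 - q) * l], still within the allowed range. *)
Lemma mgf_bound_step (d : measure_display) (Omega : measurableType d)
    (R : realType) (m : nat) (v : forall t : nat, nat -> Omega -> 'I_t.+1)
    (G : forall t : nat, nat -> Omega -> 'M[nat]_t.+1)
    (delta : nat -> R) (P : probability Omega R) (t i : nat) (mu sg : R) :
  (forall (t i : nat) (u : 'I_t.+1), measurable [set w | v t i w = u]) ->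
  graph_process m v G -> attachment_law m v G delta P ->
  - m%:R < delta t.+1 -> (0 < t)%N -> (i < m)%N ->
  discrete (G t.+1 i) -> (forall w, attach_inv m i (G t.+1 i w)) ->
  0 <= sg -> mgf_bound P (G t.+1 i) (num_old_deg m (t := t)) mu sg ->
  mgf_bound P (G t.+1 i.+1) (num_old_deg m (t := t))
    ((1 - attach_rate m (delta t.+1) t i) * mu) (sg + 1).
Proof.
move=> v_meas [_ _ Gedge] law d0 t0 im dX iX sg0 IH L' l uL' YL' l12.
have YE w : G t.+1 i.+1 w = add_edge (G t.+1 i w) (v t i.+1 w).
  by rewrite Gedge.
have [_ mY] := discrete_comp2 dX (v_meas t i.+1) YE.
have [[L uL XL] mX] := dX.
rewrite (fexp_comp2 P _ mX (v_meas t i.+1) mY YE uL uL' XL YL').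
set q := attach_rate _ _ _ _.
have q0 : 0 <= q by exact: attach_rate_ge0.
have q1 : q <= 1 by exact: attach_rate_le1.
have l12' : `|(1 - q) * l| <= 1 / 2.
  rewrite normrM ger0_norm; last lra.
  by apply: le_trans l12; rewrite ler_piMl//; lra.
apply: (@le_trans _ _ (\sum_(x <- L) pr P [set w | G t.+1 i w = x] *
    (expR (l ^+ 2 / 2) * expR ((1 - q) * l * ((num_old_deg m x)%:R - mu))))).
  apply: ler_sum => x _; set p := pr P [set w | G t.+1 i w = x].
  have mI u : measurable ([set w | v t i.+1 w = u] `&` [set w | G t.+1 i w = x]).
    exact: measurableI.
  (* The attachment law says nothing on null atoms, but there both sides vanish. *)
  have [p0|p0] := eqVneq p 0.
    rewrite big1 ?p0 ?mul0r// => u _.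
    rewrite [pr _ _](_ : _ = 0) ?mul0r//; apply: le_anti.
    by rewrite pr_ge0 -p0 pr_le// => w [].
  have Pn0 : P [set w | G t.+1 i w = x] != 0%E by rewrite prE// eqe.
  (* A value of positive probability is attained at some [w], where the invariant is known. *)
  have iA : attach_inv m i x.
    have [w <-] : [set w | G t.+1 i w = x] !=set0.
      by apply/set0P/eqP => e0; rewrite e0 measure0 eqxx in Pn0.
    exact: iX.
  rewrite (eq_bigr (fun u => p * (attach_prob (delta t.+1) x u *
      expR (l * ((num_old_deg m (add_edge x u))%:R - (1 - q) * mu))))).
    by rewrite -mulr_sumr ler_wpM2l ?pr_ge0//; apply: attach_step_mgf.
  move=> u _; rewrite mulrA; congr (_ * _).
  rewrite -(law t i.+1 x u t0 _ Pn0)//.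
  by rewrite /cond_prob mulrC divfK.
rewrite (eq_bigr (fun x => expR (l ^+ 2 / 2) * (pr P [set w | G t.+1 i w = x] *
    expR ((1 - q) * l * ((num_old_deg m x)%:R - mu))))); last first.
  by move=> x _; rewrite mulrCA.
rewrite -mulr_sumr.
apply: le_trans (ler_wpM2l (expR_ge0 _) (IH _ _ uL XL l12')) _.
rewrite -expRD ler_expR.
have : 0 <= (1 - (1 - q) ^+ 2) * (l ^+ 2 * sg).
  apply: mulr_ge0; last by rewrite mulr_ge0// sqr_ge0.
  by rewrite subr_ge0 exprn_ile1//; lra.
lra.
Qed.

(* [mean_deg m delta s] is the mean of [N_m] at time [s.+1]. *)
Fixpoint mean_deg (R : realType) (m : nat) (delta : nat -> R) (s : nat) : R :=
  if s is s'.+1 then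
    1 + mean_deg m delta s' * \prod_(i < m) (1 - attach_rate m (delta s.+1) s i)
  else 2.

(** The mean of [num_old_deg m] on [G s.+2 i], that is, after [i] edges of vertex [s.+2]. *)
Definition mean_old_deg (R : realType) (m : nat) (delta : nat -> R)
    (s i : nat) : R :=
  mean_deg m delta s * \prod_(j < i) (1 - attach_rate m (delta s.+2) s.+1 j).

Lemma mean_degS (R : realType) (m : nat) (delta : nat -> R) (s : nat) :
  mean_deg m delta s.+1 = 1 + mean_old_deg m delta s m.
Proof. by []. Qed.

Lemma mean_old_degS (R : realType) (m : nat) (delta : nat -> R) (s i : nat) :
  mean_old_deg m delta s i.+1
    = (1 - attach_rate m (delta s.+2) s.+1 i) * mean_old_deg m delta s i.
Proof. by rewrite /mean_old_deg big_ord_recr /= mulrA mulrC. Qed.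

(** Induction on time, carrying the finite range and the degree invariant along because each edge
    step uses them. The proxy is the number of random edges: the [m] edges of [G 1] are
    deterministic. *)
Lemma process_state (d : measure_display) (Omega : measurableType d)
    (R : realType) (m : nat) (v : forall t : nat, nat -> Omega -> 'I_t.+1)
    (G : forall t : nat, nat -> Omega -> 'M[nat]_t.+1)
    (delta : nat -> R) (P : probability Omega R) (s : nat) :
  (forall (t i : nat) (u : 'I_t.+1), measurable [set w | v t i w = u]) ->
  graph_process m v G -> attachment_law m v G delta P ->
  (forall t, - m%:R < delta t) ->
  [/\ discrete (G s.+1 m), forall w, full_inv m (G s.+1 m w) &
      mgf_bound P (G s.+1 m) (num_deg m (t := s.+1)) (mean_deg m delta s)
        (m * s)%:R].
Proof.
move=> v_meas Gproc law d0; have [G1 Gvertex Gedge] := Gproc.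
elim: s => [|s [dG iG mG]].
  have dG : discrete (G 1%N m).
    have d1 : discrete (fun _ : Omega => tt).
      split; first by exists [:: tt].
      case; rewrite (_ : [set _ | _] = setT); first exact: measurableT.
      by apply/seteqP; split.
    exact: (discrete_comp (phi := fun=> init_graph m) d1 G1).
  split=> //; first by move=> w; rewrite G1; exact: full_inv_init.
  move=> L l uL XL _; have [_ mX] := dG.
  (* With proxy 0 the right-hand side is 1, the total mass, and the count is constantly its mean
     2. *)
  have <- : pr P [set w | predT (G 1%N m w)] = expR (l ^+ 2 * (m * 0)%:R / 2).
    rewrite muln0 mulr0 mul0r expR0 /pr (_ : [set _ | _] = setT) ?probability_setT//.
    by apply/seteqP; split.
  rewrite (fexp_indic _ _ mX uL XL) /fexp.
  rewrite le_eqVlt; apply/orP; left; apply/eqP/eq_bigr => x _.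
  have [->|p0] := eqVneq (pr P [set w | G 1%N m w = x]) 0; first by rewrite !mul0r.
  have [w <-] : [set w | G 1%N m w = x] !=set0.
    by apply/set0P/eqP => e0; rewrite e0 /pr measure0 eqxx in p0.
  congr (_ * _); rewrite G1 (_ : num_deg m _ = 2) ?subrr ?mulr0 ?expR0//.
  rewrite /num_deg (eq_card (B := predT)) ?card_ord// => u; rewrite !inE.
  rewrite /degree !big_ord_recl big_ord0 /= !mxE.
  by case: u => [[|[|]]] //= *; rewrite ?addn0 eqxx.
(* Inner induction over the edges of the vertex that arrives at time [s.+2]. *)
have H i : (i <= m)%N -> [/\ discrete (G s.+2 i),
    forall w, attach_inv m i (G s.+2 i w) &
    mgf_bound P (G s.+2 i) (num_old_deg m (t := s.+1)) (mean_old_deg m delta s i)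
      (m * s + i)%:R].
  elim: i => [_|i IH im].
    have GE w := Gvertex s.+1 w isT.
    have dG0 := discrete_comp dG GE.
    split=> //; first by move=> w; rewrite GE; exact: attach_inv0.
    move=> L' l uL' YL' l12.
    have [[L uL XL] mX] := dG; have [_ mY] := dG0.
    rewrite (fexp_comp P _ mX mY GE uL uL' XL YL') addn0.
    apply: le_trans (mG _ _ uL XL l12); apply: fexp_le => x /=.
    by rewrite num_old_deg_add_vertex /mean_old_deg big_ord0 mulr1.
  have [dX iX mX] := IH (ltnW im).
  have YE w : G s.+2 i.+1 w = add_edge (G s.+2 i w) (v s.+1 i.+1 w).
    by rewrite Gedge.
  split; first exact: (discrete_comp2 dX (v_meas s.+1 i.+1) YE).
    by move=> w; rewrite YE; exact: attach_invS.
  rewrite mean_old_degS addnS -(natr1 (m * s + i)).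
  exact: (mgf_bound_step v_meas Gproc law).
have [dG' iG' mG'] := H m (leqnn m); split=> //.
  by move=> w; exact: attach_inv_full.
move=> L l uL XL l12; rewrite mulnS addnC.
apply: le_trans (mG' _ _ uL XL l12).
apply: ler_sum => x _.
have [->|p0] := eqVneq (pr P [set w | G s.+2 m w = x]) 0; first by rewrite !mul0r.
have [w <-] : [set w | G s.+2 m w = x] !=set0.
  by apply/set0P/eqP => e0; rewrite e0 /pr measure0 eqxx in p0.
(* The completed vertex has degree exactly [m]: it adds one to the count, which is the [1 +] in
   [mean_deg]. *)
have [_ _ e] := iG' w.
rewrite ler_wpM2l ?pr_ge0// num_deg_old e eqxx mean_degS natrD.
rewrite le_eqVlt; apply/orP; left; apply/eqP; congr (expR (l * _)) => /=.
by ring.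
Qed.

(** * Two-sided Chernoff bound *)

(** The indicator of [x <= z] is at most [expR (z - x)]. The sign of [l] is left free so that both
    tails follow. *)
Lemma mgf_chernoff (d : measure_display) (Omega : measurableType d)
    (R : realType) (P : probability Omega R) (T : eqType) (X : Omega -> T)
    (K : T -> nat) (mu sg l x : R) :
  discrete X -> mgf_bound P X K mu sg -> `|l| <= 1 / 2 ->
  pr P [set w | x <= l * ((K (X w))%:R - mu)]
    <= expR (- x) * expR (l ^+ 2 * sg / 2).
Proof.
move=> [[L uL XL] mX] mK l12.
rewrite (fexp_indic P [pred y | x <= l * ((K y)%:R - mu)] mX uL XL).
apply: le_trans (ler_wpM2l (expR_ge0 _) (mK _ _ uL XL l12)).
rewrite mulr_sumr; apply: ler_sum => y _ /=.
rewrite mulrCA ler_wpM2l ?pr_ge0// -expRD.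
case: (leP x (l * ((K y)%:R - mu))) => [xy|_] /=; last by rewrite mulr0n expR_ge0.
by rewrite mulr1n -[X in X <= _]expR0 ler_expR; lra.
Qed.

Lemma mgf_tail (d : measure_display) (Omega : measurableType d)
    (R : realType) (P : probability Omega R) (T : eqType) (X : Omega -> T)
    (K : T -> nat) (mu sg x : R) :
  discrete X -> mgf_bound P X K mu sg -> 0 < sg -> 0 <= x <= sg / 2 ->
  pr P [set w | x <= `|(K (X w))%:R - mu|] <= 2 * expR (- (x ^+ 2 / (2 * sg))).
Proof.
move=> dX mK sg0 /andP[x0 xsg]; have [[L uL XL] mX] := dX.
(* This minimises [l ^+ 2 * sg / 2 - l * x]; the restriction to [l <= 1 / 2] is the hypothesis
   [x <= sg / 2]. *)
pose l := x / sg.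
have l0 : 0 <= l by rewrite divr_ge0// ltW.
have l12 : `|l| <= 1 / 2.
  by rewrite ger0_norm// ler_pdivrMr//; lra.
have lN12 : `|- l| <= 1 / 2 by rewrite normrN.
have E : expR (- (l * x)) * expR (l ^+ 2 * sg / 2) = expR (- (x ^+ 2 / (2 * sg))).
  rewrite -expRD; congr expR; rewrite /l; field; lra.
have m1 y : measurable [set w | y <= l * ((K (X w))%:R - mu)].
  exact: (measurable_preim [pred z | y <= l * ((K z)%:R - mu)] mX XL).
have m2 y : measurable [set w | y <= - l * ((K (X w))%:R - mu)].
  exact: (measurable_preim [pred z | y <= - l * ((K z)%:R - mu)] mX XL).
apply: (@le_trans _ _ (pr P ([set w | l * x <= l * ((K (X w))%:R - mu)] `|`
                      [set w | l * x <= - l * ((K (X w))%:R - mu)]))).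
  apply: pr_le; last 2 first.
  - exact: measurableU.
  - move=> w /=; rewrite ler_normr => /orP[h|h]; [left|right] => /=.
      exact: ler_wpM2l.
    by rewrite mulNr -mulrN ler_wpM2l.
  exact: (measurable_preim [pred z | x <= `|(K z)%:R - mu|] mX XL).
apply: le_trans (prU_le _ (m1 _) (m2 _)) _.
have := mgf_chernoff (l * x) dX mK lN12; rewrite sqrrN E.
have := mgf_chernoff (l * x) dX mK l12; rewrite E.
lra.
Qed.

(** * The slope [p_m] and the deterministic recursion for the mean *)

Lemma p_mE (R : realType) (m : nat) (delta : R) :
  (0 < m)%N -> - m%:R < delta ->
  p_m m delta = (2 * m%:R + delta)
                / (2 * m%:R + delta + m%:R * (m%:R + delta)).
Proof.
move=> m0 d0; have m0' : 0 < m%:R :> R by rewrite ltr0n.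
have h : 0 < m%:R * (m%:R + delta) by apply: mulr_gt0 => //; lra.
by rewrite /p_m; field; rewrite !gt_eqF//; lra.
Qed.

Lemma p_m_gt0 (R : realType) (m : nat) (delta : R) :
  (0 < m)%N -> - m%:R < delta -> 0 < p_m m delta.
Proof.
move=> m0 d0; have m0' : 0 < m%:R :> R by rewrite ltr0n.
have h : 0 < m%:R * (m%:R + delta) by apply: mulr_gt0 => //; lra.
by rewrite p_mE// divr_gt0//; lra.
Qed.

Lemma p_m_le1 (R : realType) (m : nat) (delta : R) :
  (0 < m)%N -> - m%:R < delta -> p_m m delta <= 1.
Proof.
move=> m0 d0; have m0' : 0 < m%:R :> R by rewrite ltr0n.
have h : 0 < m%:R * (m%:R + delta) by apply: mulr_gt0 => //; lra.
by rewrite p_mE// ler_pdivrMr; lra.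
Qed.

(* The limit of [t * attach_rate m delta t i] as [t] tends to infinity. *)
Definition drift (R : realType) (m : nat) (delta : R) : R :=
  (m%:R + delta) / (2 * m%:R + delta).

Lemma drift_ge0 (R : realType) (m : nat) (delta : R) :
  - m%:R < delta -> 0 <= drift m delta.
Proof.
move=> d0; have m0' : 0 <= m%:R :> R by exact: ler0n.
by rewrite divr_ge0//; lra.
Qed.

(** This is the balance [p = 1 - p * (m * drift)]: on the line of slope [p], each arrival adds one
    vertex of degree [m] and its [m] edges remove about [p * drift] each. *)
Lemma p_m_drift (R : realType) (m : nat) (delta : R) :
  (0 < m)%N -> - m%:R < delta ->
  m%:R * drift m delta = (p_m m delta)^-1 - 1.
Proof.
move=> m0 d0; have m0' : 0 < m%:R :> R by rewrite ltr0n.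
have h : 0 < m%:R * (m%:R + delta) by apply: mulr_gt0 => //; lra.
by rewrite p_mE// /drift; field; rewrite !gt_eqF//; lra.
Qed.

(** By the balance equation the drifts agree, and cross-multiplying them leaves
    [m * (delta0 - delta1) = 0]. It ensures that the change of parameter shifts the mean. *)
Lemma p_m_inj (R : realType) (m : nat) (delta0 delta1 : R) :
  (0 < m)%N -> - m%:R < delta0 -> - m%:R < delta1 ->
  p_m m delta0 = p_m m delta1 -> delta0 = delta1.
Proof.
move=> m0 d0 d1 pE; have m0' : 0 < m%:R :> R by rewrite ltr0n.
have := p_m_drift m0 d0; rewrite pE -p_m_drift// => /(mulfI _).
rewrite gt_eqF// => /(_ isT) /eqP; rewrite /drift.
have n0 : 2 * m%:R + delta0 != 0 by rewrite gt_eqF//; lra.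
have n1 : 2 * m%:R + delta1 != 0 by rewrite gt_eqF//; lra.
rewrite eqr_div// => /eqP e.
have : m%:R * (delta0 - delta1) = 0 by lra.
by move/eqP; rewrite mulf_eq0 gt_eqF//= subr_eq0 => /eqP.
Qed.

(* The deviation from a linear guess becomes a convex combination of itself and
   of the distance from the guess to the instantaneous equilibrium. *)
Lemma mean_old_deg_dev_rec (R : realType) (m : nat) (delta : nat -> R)
    (s i : nat) (p x : R) : - m%:R < delta s.+2 ->
  mean_old_deg m delta s i.+1 - (x - i.+1%:R * (p * drift m (delta s.+2)))
  = (1 - attach_rate m (delta s.+2) s.+1 i)
      * (mean_old_deg m delta s i - (x - i%:R * (p * drift m (delta s.+2))))
    + attach_rate m (delta s.+2) s.+1 i
      * (p * ((2 * m * s.+1 + i)%:R + s.+2%:R * delta s.+2)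
           / (2 * m%:R + delta s.+2)
         - (x - i%:R * (p * drift m (delta s.+2)))).
Proof.
move=> d0; have S0 := attach_weight_gt0 i d0 (ltn0Sn s).
have m0 : 0 <= m%:R :> R by exact: ler0n.
rewrite mean_old_degS; move: S0; rewrite /attach_rate /drift.
set M := mean_old_deg _ _ _ _; set S := (_ + _ * _) => S0.
rewrite -(natr1 i); field; rewrite !gt_eqF//; lra.
Qed.

(** Both bounds read off the convex combination. The one by a maximum does not accumulate over time
    and serves before the change; the additive one, from a rate of at most [1 / s.+2], serves after
    it, where [D] grows. *)
Lemma mean_old_deg_dev_le (R : realType) (m : nat) (delta : nat -> R)
    (s i : nat) (p x E D : R) :
  - m%:R < delta s.+2 ->
  `|mean_deg m delta s - x| <= E ->
  (forall j, (j < m)%N ->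
     `|p * ((2 * m * s.+1 + j)%:R + s.+2%:R * delta s.+2)
           / (2 * m%:R + delta s.+2)
         - (x - j%:R * (p * drift m (delta s.+2)))| <= D) ->
  (i <= m)%N ->
  `|mean_old_deg m delta s i - (x - i%:R * (p * drift m (delta s.+2)))|
    <= Num.max E D /\
  `|mean_old_deg m delta s i - (x - i%:R * (p * drift m (delta s.+2)))|
    <= E + i%:R * D / s.+2%:R.
Proof.
move=> d0 hE hD; elim: i => [_|i IH im].
  rewrite /mean_old_deg big_ord0 mulr1 !mul0r subr0 addr0.
  by split=> //; rewrite le_max hE.
have [IH1 IH2] := IH (ltnW im); rewrite mean_old_deg_dev_rec//.
have q0 := attach_rate_ge0 i d0 (ltn0Sn s).
have q1 := attach_rate_le1 i d0 (ltn0Sn s).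
have q2 := attach_rate_le i d0 (ltn0Sn s).
have hDi := hD i im.
have D0 : 0 <= D by exact: le_trans (normr_ge0 _) hDi.
set q := attach_rate _ _ _ _ in q0 q1 q2 *.
have hDm : D <= Num.max E D by rewrite le_max lexx orbT.
move: IH1 IH2 hDi; set e := mean_old_deg _ _ _ _ - _; set f := (_ / _ - _).
move: q e f q0 q1 q2 => q e f q0 q1 q2 IH1 IH2 hDi.
have T : `|(1 - q) * e + q * f| <= (1 - q) * `|e| + q * `|f|.
  apply: le_trans (ler_normD _ _) _.
  by rewrite !normrM (ger0_norm q0) ger0_norm//; lra.
split; apply: (le_trans T).
  have : (1 - q) * `|e| <= (1 - q) * Num.max E D by rewrite ler_wpM2l//; lra.
  have : q * `|f| <= q * Num.max E D by rewrite ler_wpM2l// (le_trans hDi).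
  lra.
have : q * `|e| >= 0 by rewrite mulr_ge0.
have : q * `|f| <= D / s.+2%:R.
  rewrite ler_pdivlMr ?ltr0n//.
  have h : 0 <= (s.+2%:R : R) by exact: ler0n.
  have := ler_wpM2r h (ler_wpM2l q0 hDi).
  have := ler_wpM2r D0 q2.
  lra.
move: IH2; rewrite -(natr1 i); set V := s.+2%:R^-1; move: V => V IH2 *; lra.
Qed.

(** * Bias of the mean before and after the change *)

(** Bounds, uniformly in the number of edges drawn, the distance from the line [p * t] to the
    instantaneous equilibrium. *)
Definition drift_gap (R : realType) (m : nat) (p delta : R) : R :=
  p * (1 + 2 * m%:R / (2 * m%:R + delta) + m%:R * drift m delta).

Lemma drift_gap_ge0 (R : realType) (m : nat) (p delta : R) :
  0 <= p -> - m%:R < delta -> 0 <= drift_gap m p delta.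
Proof.
move=> p0 d0; have m0 : 0 <= m%:R :> R by exact: ler0n.
apply: mulr_ge0 => //; apply: addr_ge0; last by rewrite mulr_ge0// drift_ge0.
by rewrite addr_ge0// divr_ge0//; lra.
Qed.

Lemma drift_gap_le (R : realType) (m t j : nat) (p x delta : R) :
  0 <= p -> - m%:R < delta -> (j < m)%N ->
  `|p * ((2 * m * t + j)%:R + t.+1%:R * delta) / (2 * m%:R + delta)
     - (x - j%:R * (p * drift m delta))|
  <= `|p * t%:R - x| + drift_gap m p delta.
Proof.
move=> p0 d0 jm; have m0 : 0 <= m%:R :> R by exact: ler0n.
have D0 : 0 < 2 * m%:R + delta by lra.
pose y := m%:R / (2 * m%:R + delta); pose z : R := j%:R / (2 * m%:R + delta).
have jm' : j%:R <= m%:R :> R by rewrite ler_nat ltnW.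
have z0 : 0 <= z by rewrite divr_ge0// ltW.
have zy : z <= y by rewrite ler_pM2r ?invr_gt0.
have -> : p * ((2 * m * t + j)%:R + t.+1%:R * delta) / (2 * m%:R + delta)
     - (x - j%:R * (p * drift m delta))
   = (p * t%:R - x) + p * (1 + z - 2 * y + j%:R * drift m delta).
  rewrite /z /y /drift natrD !natrM -(natr1 t); field; lra.
apply: le_trans (ler_normD _ _) _; rewrite lerD2l normrM (ger0_norm p0).
rewrite /drift_gap; apply: ler_wpM2l => //.
have a0 := drift_ge0 d0.
have h1 : 0 <= j%:R * drift m delta by rewrite mulr_ge0.
have h2 : j%:R * drift m delta <= m%:R * drift m delta by rewrite ler_wpM2r.
have -> : 2 * m%:R / (2 * m%:R + delta) = 2 * y by rewrite /y mulrA.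
have y1 : 2 * y <= 2 * y + 1 by lra.
by rewrite ler_norml; apply/andP; split; lra.
Qed.

(** The guess [s.+1 * p_m] is reproduced exactly by one time step, thanks to [p_m_drift], so the
    error never exceeds the larger of its initial value and the gap. *)
Lemma mean_deg_before (R : realType) (m tau : nat) (delta : nat -> R)
    (delta0 : R) (s : nat) :
  (0 < m)%N -> - m%:R < delta0 ->
  (forall u, (u <= tau)%N -> delta u = delta0) -> (s < tau)%N ->
  `|mean_deg m delta s - s.+1%:R * p_m m delta0|
    <= 2 + drift_gap m (p_m m delta0) delta0.
Proof.
move=> m0 d0 hd; have p0 := p_m_gt0 m0 d0; have p1 := p_m_le1 m0 d0.
have g0 := drift_gap_ge0 (ltW p0) d0.
elim: s => [_|s IH st]; first by rewrite mul1r /= ger0_norm; lra.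
have E := IH (ltnW st).
have dE : delta s.+2 = delta0 by rewrite hd.
have dlt : - m%:R < delta s.+2 by rewrite dE.
have := mean_old_deg_dev_le (p := p_m m delta0)
  (D := drift_gap m (p_m m delta0) delta0) dlt E _ (leqnn m).
case.
  move=> j jm; rewrite dE.
  apply: le_trans (drift_gap_le _ _ (ltW p0) d0 jm) _.
  by rewrite mulrC subrr normr0 add0r.
rewrite dE [m%:R * _]mulrCA p_m_drift// mean_degS -(natr1 s.+1) => h _.
have -> : 1 + mean_old_deg m delta s m - (s.+1%:R + 1) * p_m m delta0 =
  mean_old_deg m delta s m - (s.+1%:R * p_m m delta0 -
     p_m m delta0 * ((p_m m delta0)^-1 - 1)) by field; lra.
apply: le_trans h _; rewrite ge_max lexx /=; lra.
Qed.

(** The mean is still near the old line, so under [delta1] a time step changes it by about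
    [1 - p0 * (1 / p1 - 1) = p0 + rho], where [p0] and [p1] are the two slopes. Departing from that
    line by [k * rho] costs an error of order [k / tau] per step. *)
Lemma mean_deg_after (R : realType) (m tau : nat) (delta : nat -> R)
    (delta0 delta1 B rho : R) (k : nat) :
  (0 < m)%N -> - m%:R < delta0 -> - m%:R < delta1 ->
  rho = 1 - p_m m delta0 / p_m m delta1 ->
  `|mean_deg m delta tau - tau.+1%:R * p_m m delta0| <= B ->
  (forall u, (tau.+1 < u <= tau.+1 + k)%N -> delta u = delta1) ->
  `|mean_deg m delta (tau + k) - ((tau.+1 + k)%:R * p_m m delta0 + k%:R * rho)|
    <= B + k%:R * (m%:R * (k%:R * `|rho| + drift_gap m (p_m m delta0) delta1))
           / tau.+1%:R.
Proof.
move=> m0 d0 d1 rhoE hB; have p0 := p_m_gt0 m0 d0; have p1 := p_m_gt0 m0 d1.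
have g0 := drift_gap_ge0 (ltW p0) d1.
elim: k => [_|k IH hd]; first by rewrite !mul0r !addr0 !addn0.
have /IH E : forall u, (tau.+1 < u <= tau.+1 + k)%N -> delta u = delta1.
  by move=> u /andP[u1 u2]; rewrite hd// u1 (leq_trans u2)// leq_add2l.
have dE : delta (tau + k).+2 = delta1.
  by rewrite hd// !addSn addnS ltnS leqnn andbT !ltnS leq_addr.
have dlt : - m%:R < delta (tau + k).+2 by rewrite dE.
have := mean_old_deg_dev_le (p := p_m m delta0)
  (D := k%:R * `|rho| + drift_gap m (p_m m delta0) delta1) dlt E _ (leqnn m).
case.
  move=> j jm; rewrite dE.
  apply: le_trans (drift_gap_le _ _ (ltW p0) d1 jm) _.
  rewrite lerD2r addSn mulrC opprD addrA subrr add0r normrN normrM.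
  by rewrite ger0_norm.
rewrite dE [m%:R * _]mulrCA p_m_drift// addnS mean_degS => _ h.
have -> : 1 + mean_old_deg m delta (tau + k) m -
    ((tau.+1 + k.+1)%:R * p_m m delta0 + k.+1%:R * rho) =
  mean_old_deg m delta (tau + k) m - ((tau.+1 + k)%:R * p_m m delta0
     + k%:R * rho - p_m m delta0 * ((p_m m delta1)^-1 - 1)).
  rewrite addnS -!natr1 rhoE; field; lra.
apply: le_trans h _; rewrite -addrA lerD2l.
set D := k%:R * `|rho| + _.
have D0 : 0 <= D by rewrite addr_ge0// mulr_ge0.
have m0' : 0 <= m%:R :> R by exact: ler0n.
have mD0 : 0 <= m%:R * D by rewrite mulr_ge0.
(* The step error has denominator [(tau + k).+2]; the smaller [tau.+1] makes all the errors
   addable. *)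
apply: (@le_trans _ _ (k%:R * (m%:R * D) / tau.+1%:R + m%:R * D / tau.+1%:R)).
  rewrite lerD2l ler_wpM2l// lef_pV2 ?posrE ?ltr0n// ler_nat.
  by rewrite ltnS ltnW// ltnS leq_addr.
rewrite -mulrDl ler_wpM2r ?invr_ge0 ?ler0n// -(natr1 k).
have -> : k%:R * (m%:R * D) + m%:R * D = (k%:R + 1) * (m%:R * D) by ring.
rewrite !ler_wpM2l// ?addr_ge0 ?ler0n ?ler01//.
by rewrite /D lerD2r ler_wpM2r// lerDl.
Qed.

(** The constant is chosen before [delta], [tau] and [k], so that it survives a change time
    depending on [n]. The change occurs after time [tau.+1], the time described by [mean_deg] at
    index [tau]. *)
Lemma mean_deg_bias (R : realType) (m : nat) (delta0 delta1 : R) :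
  (0 < m)%N -> - m%:R < delta0 -> - m%:R < delta1 ->
  exists2 C : R, 0 < C & forall (delta : nat -> R) (tau k : nat),
    (forall u, (u <= tau.+1)%N -> delta u = delta0) ->
    (forall u, (tau.+1 < u <= tau.+1 + k)%N -> delta u = delta1) ->
    `|mean_deg m delta (tau + k) - (tau.+1 + k)%:R * p_m m delta0
      - k%:R * (1 - p_m m delta0 / p_m m delta1)|
    <= C * (1 + k%:R * (1 + k%:R) / tau.+1%:R).
Proof.
move=> m0 d0 d1; have p0 := p_m_gt0 m0 d0; have p1 := p_m_gt0 m0 d1.
have m0' : 0 <= m%:R :> R by exact: ler0n.
set rho := 1 - _; pose g0 := drift_gap m (p_m m delta0) delta0.
pose g1 := drift_gap m (p_m m delta0) delta1.
have g00 : 0 <= g0 by exact: (drift_gap_ge0 (ltW p0) d0).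
have g10 : 0 <= g1 by exact: (drift_gap_ge0 (ltW p0) d1).
have n0 : 0 <= `|rho| by [].
have C0 : 0 <= m%:R * (`|rho| + g1) by rewrite mulr_ge0// addr_ge0.
exists (2 + g0 + m%:R * (`|rho| + g1)); first lra.
move=> delta tau k h0 h1.
have := mean_deg_after (rho := rho) m0 d0 d1 erefl
  (mean_deg_before m0 d0 h0 (ltnSn tau)) h1.
rewrite opprD addrA => /le_trans; apply.
rewrite -/g0 -/g1.
have : 0 <= (tau.+1%:R : R)^-1 by rewrite invr_ge0.
move: (tau.+1%:R)^-1 => V V0.
have K0 : 0 <= k%:R :> R by exact: ler0n.
have : 0 <= k%:R * m%:R * (`|rho| + k%:R * g1) * V.
  by rewrite !mulr_ge0// addr_ge0// mulr_ge0.
have : 0 <= (2 + g0) * (k%:R * (1 + k%:R) * V).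
  by rewrite !mulr_ge0//; lra.
lra.
Qed.

(** * Non-asymptotic error bounds for the test *)

Lemma mgf_bound_le (d : measure_display) (Omega : measurableType d)
    (R : realType) (P : probability Omega R) (T : eqType) (X : Omega -> T)
    (K : T -> nat) (mu sg sg' : R) :
  sg <= sg' -> mgf_bound P X K mu sg -> mgf_bound P X K mu sg'.
Proof.
move=> sgle mK L l uL XL l12; apply: le_trans (mK _ _ uL XL l12) _.
by rewrite ler_expR ler_wpM2r ?invr_ge0// ler_wpM2l// sqr_ge0.
Qed.

(** The proxy [m * n.-1] is enlarged to [m * n], which is positive even for [n = 1]. *)
Lemma num_deg_tail (d : measure_display) (Omega : measurableType d)
    (R : realType) (m : nat) (v : forall t : nat, nat -> Omega -> 'I_t.+1)
    (G : forall t : nat, nat -> Omega -> 'M[nat]_t.+1)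
    (delta : nat -> R) (P : probability Omega R) (n : nat) (x : R) :
  (0 < m)%N ->
  (forall (t i : nat) (u : 'I_t.+1), measurable [set w | v t i w = u]) ->
  graph_process m v G -> attachment_law m v G delta P ->
  (forall t, - m%:R < delta t) -> (0 < n)%N -> 0 <= x <= (m * n)%:R / 2 ->
  pr P [set w | x <= `|(num_deg m (G n m w))%:R - mean_deg m delta n.-1|]
    <= 2 * expR (- (x ^+ 2 / (2 * (m * n)%:R))).
Proof.
case: n => // s m0 v_meas Gproc law d0 _ hx.
have [dG _ mG] := process_state s v_meas Gproc law d0.
apply: (mgf_tail dG) => //; last by rewrite ltr0n muln_gt0 m0.
by apply: mgf_bound_le mG; rewrite ler_nat leq_mul2l leqnSn orbT.
Qed.

Definition threshold (R : realType) (m : nat) (alpha : R) (n : nat) : R :=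
  m%:R * Num.sqrt (8 * n%:R * ln (2 / alpha)).

Lemma ln_level_gt0 (R : realType) (alpha : R) :
  0 < alpha < 1 -> 0 < ln (2 / alpha).
Proof. by move=> /andP[a0 a1]; rewrite ln_gt0// ltr_pdivlMr//; lra. Qed.

Lemma thresholdE (R : realType) (m : nat) (alpha : R) (n : nat) :
  0 < alpha < 1 ->
  threshold m alpha n
    = m%:R * Num.sqrt 8 * Num.sqrt (ln (2 / alpha)) * Num.sqrt n%:R.
Proof.
move=> /ln_level_gt0/ltW L0; rewrite /threshold sqrtrM ?mulr_ge0//.
by rewrite sqrtrM//; ring.
Qed.

Lemma threshold_sqr (R : realType) (m : nat) (alpha : R) (n : nat) :
  0 < alpha < 1 ->
  threshold m alpha n ^+ 2 = m%:R ^+ 2 * (8 * n%:R * ln (2 / alpha)).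
Proof.
move=> /ln_level_gt0/ltW L0; rewrite exprMn sqr_sqrtr//.
by rewrite !mulr_ge0.
Qed.

Lemma measurable_graph_event (d : measure_display) (Omega : measurableType d)
    (R : realType) (m : nat) (v : forall t : nat, nat -> Omega -> 'I_t.+1)
    (G : forall t : nat, nat -> Omega -> 'M[nat]_t.+1)
    (delta : nat -> R) (P : probability Omega R) (n : nat)
    (Q : pred 'M[nat]_n.+1) :
  (forall (t i : nat) (u : 'I_t.+1), measurable [set w | v t i w = u]) ->
  graph_process m v G -> attachment_law m v G delta P ->
  (forall t, - m%:R < delta t) -> (0 < n)%N ->
  measurable [set w | Q (G n m w)].
Proof.
case: n Q => // s Q v_meas Gproc law d0 _.
have [[[L uL XL] mX] _ _] := process_state s v_meas Gproc law d0.
exact: (measurable_preim Q mX XL).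
Qed.

(** Half of the threshold absorbs the bias and half is left to fluctuations. The exponent becomes
    [m * ln (2 / alpha)], and [m >= 1] gives [alpha]. With [delta] arbitrary, this covers the null
    model and also the undetectable alternatives. *)
Lemma pr_reject_le (d : measure_display) (Omega : measurableType d)
    (R : realType) (m : nat) (v : forall t : nat, nat -> Omega -> 'I_t.+1)
    (G : forall t : nat, nat -> Omega -> 'M[nat]_t.+1)
    (delta : nat -> R) (P : probability Omega R) (n : nat)
    (delta0 alpha : R) :
  (0 < m)%N ->
  (forall (t i : nat) (u : 'I_t.+1), measurable [set w | v t i w = u]) ->
  graph_process m v G -> attachment_law m v G delta P ->
  (forall t, - m%:R < delta t) -> (0 < n)%N -> 0 < alpha < 1 ->
  threshold m alpha n <= m%:R * n%:R ->
  `|mean_deg m delta n.-1 - n%:R * p_m m delta0| <= threshold m alpha n / 2 ->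
  pr P [set w | test m delta0 alpha (G n m w) != 0%N] <= alpha.
Proof.
move=> m0 v_meas Gproc law d0 n0 a01 hthr hbias.
have /andP[a0 a1] := a01; have L0 := ln_level_gt0 a01.
have thr0 : 0 <= threshold m alpha n by rewrite mulr_ge0// sqrtr_ge0.
have m0' : 1 <= m%:R :> R by rewrite ler1n.
have n0' : 0 < n%:R :> R by rewrite ltr0n.
pose x := threshold m alpha n / 2.
have hx : 0 <= x <= (m * n)%:R / 2 by rewrite natrM /x; lra.
have meas := fun Q => measurable_graph_event Q v_meas Gproc law d0 n0.
apply: (@le_trans _ _ (2 * expR (- (x ^+ 2 / (2 * (m * n)%:R))))).
  apply: le_trans (num_deg_tail m0 v_meas Gproc law d0 n0 hx).
  apply: pr_le.
  - exact: (meas (fun A => test m delta0 alpha A != 0%N)).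
  - exact: (meas (fun A => x <= `|(num_deg m A)%:R - mean_deg m delta n.-1|)).
  move=> w /=; rewrite /test -/(threshold m alpha n); case: ifP => //= hT _.
  have := ler_distD (mean_deg m delta n.-1) (num_deg m (G n m w))%:R
    (n%:R * p_m m delta0).
  by move: hT hbias; rewrite /stat /x; lra.
have -> : x ^+ 2 / (2 * (m * n)%:R) = m%:R * ln (2 / alpha).
  rewrite /x expr_div_n threshold_sqr// natrM; field.
  by rewrite !gt_eqF//; lra.
have alphaE : 2 * expR (- ln (2 / alpha)) = alpha.
  by rewrite expRN lnK ?posrE ?divr_gt0//; field; rewrite gt_eqF.
rewrite -[leRHS]alphaE ler_wpM2l// ler_expR lerN2 ler_peMl//.
exact: ltW.
Qed.

(** Acceptance keeps the count within the threshold of [n * p_m], hence at least [y] away from a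
    mean that is biased by [y] plus the threshold. *)
Lemma pr_accept_le (d : measure_display) (Omega : measurableType d)
    (R : realType) (m : nat) (v : forall t : nat, nat -> Omega -> 'I_t.+1)
    (G : forall t : nat, nat -> Omega -> 'M[nat]_t.+1)
    (delta : nat -> R) (P : probability Omega R) (n : nat)
    (delta0 alpha y : R) :
  (0 < m)%N ->
  (forall (t i : nat) (u : 'I_t.+1), measurable [set w | v t i w = u]) ->
  graph_process m v G -> attachment_law m v G delta P ->
  (forall t, - m%:R < delta t) -> (0 < n)%N ->
  0 <= y <= (m * n)%:R / 2 ->
  y + threshold m alpha n
    <= `|mean_deg m delta n.-1 - n%:R * p_m m delta0| ->
  pr P [set w | test m delta0 alpha (G n m w) == 0%N]
    <= 2 * expR (- (y ^+ 2 / (2 * (m * n)%:R))).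
Proof.
move=> m0 v_meas Gproc law d0 n0 hy hbias.
have meas := fun Q => measurable_graph_event Q v_meas Gproc law d0 n0.
apply: le_trans (num_deg_tail m0 v_meas Gproc law d0 n0 hy).
apply: pr_le.
- exact: (meas (fun A => test m delta0 alpha A == 0%N)).
- exact: (meas (fun A => y <= `|(num_deg m A)%:R - mean_deg m delta n.-1|)).
move=> w /=; rewrite /test -/(threshold m alpha n); case: ifP => //= hT _.
have := ler_distD (num_deg m (G n m w))%:R (mean_deg m delta n.-1)
  (n%:R * p_m m delta0).
rewrite [X in _ <= X + _]distrC.
move/negbT: hT; rewrite -ltNge; move: hbias; rewrite /stat; lra.
Qed.

(** * Comparison of the bias with the threshold for large [n] *)

Lemma near_le_powR (R : realType) (a M : R) :
  0 < a -> \forall n \near \oo, M <= n%:R `^ a.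
Proof.
move=> a0; near=> n.
have h : (`|M| + 1) `^ a^-1 <= n%:R by near: n; exact: nbhs_infty_ger.
have M0 : 0 <= `|M| + 1 by rewrite addr_ge0.
apply: (@le_trans _ _ (`|M| + 1)).
  by rewrite (le_trans (ler_norm M))// lerDl.
have ME : `|M| + 1 = ((`|M| + 1) `^ a^-1) `^ a.
  by rewrite -powRrM mulVf ?gt_eqF// powRr1.
rewrite [leLHS]ME.
by apply: ge0_ler_powR => //; rewrite ?nnegrE ?powR_ge0// ltW.
Unshelve. all: by end_near. Qed.

Lemma near_le_sqrt (R : realType) (M : R) :
  \forall n \near \oo, M <= Num.sqrt n%:R.
Proof.
near=> n; rewrite -powR12_sqrt//; near: n.
by apply: near_le_powR; rewrite invr_gt0.
Unshelve. all: by end_near. Qed.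

Lemma near_powR_le (R : realType) (a b K : R) :
  a < b -> \forall n \near \oo, K * n%:R `^ a <= n%:R `^ b.
Proof.
move=> ab; near=> n.
have n0 : (0 < n)%N by near: n; exists 1%N.
have -> : b = a + (b - a) by lra.
rewrite powRD ?pnatr_eq0 -?lt0n ?n0 ?implybT// mulrC ler_wpM2l ?powR_ge0//.
by near: n; apply: near_le_powR; rewrite subr_gt0.
Unshelve. all: by end_near. Qed.

Lemma near_null_bias (R : realType) (m : nat) (delta0 alpha : R) :
  (0 < m)%N -> - m%:R < delta0 -> 0 < alpha < 1 ->
  \forall n \near \oo,
    `|mean_deg m (fun=> delta0) n.-1 - n%:R * p_m m delta0|
      <= threshold m alpha n / 2.
Proof.
move=> m0 d0 a01; have [C C0 HC] := mean_deg_bias m0 d0 d0.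
have K0 : 0 < m%:R * Num.sqrt 8 * Num.sqrt (ln (2 / alpha)) :> R.
  by rewrite !mulr_gt0 ?ltr0n ?sqrtr_gt0 ?ln_level_gt0.
near=> n.
have n0 : (0 < n)%N by near: n; exists 1%N.
(* With an empty window after the change, the bias is bounded by a constant. *)
have := HC (fun=> delta0) n.-1 0%N (fun _ _ => erefl) (fun _ _ => erefl).
rewrite !addn0 prednK// !mul0r subr0 addr0 mulr1 => /le_trans; apply.
rewrite thresholdE// ler_pdivlMr// [leRHS]mulrC -ler_pdivrMr//.
by near: n; exact: near_le_sqrt.
Unshelve. all: by end_near. Qed.

Lemma near_threshold_le (R : realType) (m : nat) (alpha : R) :
  0 < alpha < 1 -> \forall n \near \oo, threshold m alpha n <= m%:R * n%:R.
Proof.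
move=> a01; near=> n; rewrite thresholdE// -!mulrA ler_wpM2l//.
rewrite -[X in _ <= X](@sqr_sqrtr _ n%:R)// expr2 mulrA ler_wpM2r ?sqrtr_ge0//.
by near: n; exact: near_le_sqrt.
Unshelve. all: by end_near. Qed.

(** The window has length [k = c * n^gamma] up to rounding, and the error [1 + k * (1 + k) / tau] is
    of order [1 + n^(2 * gamma - 1)], negligible against [n^gamma] because [gamma < 1]. *)
Lemma near_alt_bias (R : realType) (m : nat) (delta0 delta1 c gamma e : R) :
  (0 < m)%N -> - m%:R < delta0 -> - m%:R < delta1 ->
  0 < c -> 0 < gamma < 1 -> 0 < e ->
  \forall n \near \oo,
    `|mean_deg m (delta_alt delta0 delta1 c gamma n) n.-1
       - n%:R * p_m m delta0
       - c * n%:R `^ gamma * (1 - p_m m delta0 / p_m m delta1)|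
      <= e * n%:R `^ gamma.
Proof.
move=> m0 d0 d1 c0 /andP[g0 g1] e0; have [C C0 HC] := mean_deg_bias m0 d0 d1.
set rho := 1 - _ in HC *; pose c' : R := (c + 1) * (c + 2) * 2.
near=> n; set g : R := n%:R `^ gamma.
have n1 : (0 < n)%N by near: n; exists 1%N.
have n0 : 0 < n%:R :> R by rewrite ltr0n.
have gge0 : 0 <= g by exact: powR_ge0.
have gge1 : 1 <= g by rewrite /g; near: n; exact: near_le_powR.
(* One half of [e] pays for the rounding and the constant term, the other half for the quadratic
   term. *)
have gC : `|rho| + C <= e / 2 * g.
  by rewrite mulrC -ler_pdivrMr; [rewrite /g; near: n; exact: near_le_powR|lra].
have nE : n%:R = n%:R `^ 1 :> R by rewrite powRr1.
(* Makes the change time at least [n / 2]; in particular its floor is a positive integer, of the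
   form [tau.+1]. *)
have gn : 2 * (c + 1) * g <= n%:R by rewrite nE /g; near: n; exact: near_powR_le.
have gn' : C * c' / (e / 2) * g <= n%:R.
  by rewrite nE /g; near: n; exact: near_powR_le.
have n2 : 4 <= n%:R :> R by near: n; exact: nbhs_infty_ger.
have cg0 : 0 <= c * g by rewrite mulr_ge0// ltW.
have fl0 : 0 <= Num.floor (n%:R - c * g) by rewrite floor_ge0; lra.
have [f1 f2] := andP (floor_itv (n%:R - c * g)).
rewrite /delta_alt (_ : change_time c gamma n = Num.floor (n%:R - c * g))//.
move: fl0 f1 f2; case: (Num.floor _) => [f|//] _ f1 f2.
rewrite intrD /= -!pmulrn in f1 f2.
have f0 : 0 < f%:R :> R by lra.
case: f f1 f2 f0 => [|tau] f1 f2 f0; first by rewrite ltxx in f0.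
have tn : (tau.+1 <= n)%N by rewrite -(ler_nat R); lra.
have nk : (tau.+1 + (n - tau.+1))%N = n by rewrite subnKC.
pose delta t := if t%:Z <= tau.+1 then delta0 else delta1.
have before u : (u <= tau.+1)%N -> delta u = delta0.
  by move=> ut; rewrite /delta lez_nat ut.
have after u : (tau.+1 < u <= tau.+1 + (n - tau.+1))%N -> delta u = delta1.
  by move=> /andP[ut _]; rewrite /delta lez_nat leqNgt ut.
have := HC delta tau (n - tau.+1)%N before after.
rewrite nk (_ : (tau + (n - tau.+1))%N = n.-1); last by rewrite -[in RHS]nk.
rewrite natrB//; set b := _ - _ * p_m m delta0.
move: f0 f1 f2; rewrite -/rho; set t : R := tau.+1%:R => f0 f1 f2 hb.
set k := n%:R - t in hb.
have k1 : k <= c * g + 1 by rewrite /k; lra.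
have k0 : c * g <= k by rewrite /k; lra.
have -> : b - c * g * rho = (b - k * rho) + (k - c * g) * rho by ring.
apply: le_trans (ler_normD _ _) _.
have r1 : `|(k - c * g) * rho| <= `|rho|.
  by rewrite normrM ger0_norm ?subr_ge0// ler_piMl//; lra.
(* The three factors of [c'] come from [k <= (c + 1) * g], [1 + k <= (c + 2) * g] and
   [1 / t <= 2 / n]. *)
have kt : k * (1 + k) / t <= c' * g / n%:R * g.
  have t2 : t^-1 <= 2 / n%:R.
    rewrite -[2]invrK -invfM lef_pV2 ?posrE ?mulr_gt0//; lra.
  have kg1 : k <= (c + 1) * g by lra.
  have kg2 : 1 + k <= (c + 2) * g by lra.
  have k00 : 0 <= k by lra.
  apply: (@le_trans _ _ (((c + 1) * g) * ((c + 2) * g) * (2 / n%:R))).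
    apply: ler_pM => //; [by rewrite mulr_ge0//; lra|by rewrite invr_ge0 ltW|].
    by apply: ler_pM => //; lra.
  by rewrite le_eqVlt; apply/orP; left; apply/eqP; rewrite /c'; field; rewrite gt_eqF.
have gn2 : C * (c' * g / n%:R) <= e / 2.
  have -> : C * (c' * g / n%:R) = C * c' / (e / 2) * g / n%:R * (e / 2).
    by field; rewrite !gt_eqF.
  apply: ler_piMl; first lra.
  by rewrite ler_pdivrMr// mul1r.
have hX : C * (k * (1 + k) / t) <= e / 2 * g.
  apply: le_trans (ler_wpM2l (ltW C0) kt) _.
  by rewrite mulrA ler_wpM2r.
move: hb hX r1 gC; move: (k * (1 + k) / t) `|b - _| `|_ * rho| `|rho|.
by move: g {gge0 gge1 gn gn' cg0 kt gn2 k1 k0 nE f1 f2} => g X B1 B2 B3; lra.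
Unshelve. all: by end_near. Qed.

Theorem theorem3p1 (R : realType) (m : nat) (delta0 delta1 c gamma alpha : R)
    (m_ge1 : (1 <= m)%N)
    (delta0_gt : - m%:R < delta0) (delta1_gt : - m%:R < delta1)
    (delta01 : delta0 != delta1)
    (c_gt0 : 0 < c) (gamma01 : 0 < gamma < 1) (alpha01 : 0 < alpha < 1)
    (d : measure_display) (Omega : measurableType d)
    (v : forall t : nat, nat -> Omega -> 'I_t.+1)
    (G : forall t : nat, nat -> Omega -> 'M[nat]_t.+1)
    (v_meas : forall (t i : nat) (u : 'I_t.+1),
        measurable [set w | v t i w = u])
    (G_proc : graph_process m v G)
    (P0 : probability Omega R) (P1 : nat -> probability Omega R)
    (P0_law : attachment_law m v G (fun=> delta0) P0)
    (P1_law : forall n : nat,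
        attachment_law m v G (delta_alt delta0 delta1 c gamma n) (P1 n)) :
  [/\ exists2 e : nat -> R, e n @[n --> \oo] --> (0 : R) &
        \forall n \near \oo,
          (P0 [set w | test m delta0 alpha (G n m w) <> 0%N]
             <= ((1 + e n) * alpha)%:E)%E,
      1 / 2 < gamma ->
        exists2 e : nat -> R, e n @[n --> \oo] --> (0 : R) &
          \forall n \near \oo,
            (P1 n [set w | test m delta0 alpha (G n m w) = 0%N]
               <= (e n)%:E)%E,
      gamma = 1 / 2 ->
        exists2 e : nat -> R, e n @[n --> \oo] --> (0 : R) &
          \forall n \near \oo,
            (P1 n [set w | test m delta0 alpha (G n m w) = 0%N]
               <= ((2 + e n) *
                   expR (- (Num.max
                     (c * `|1 - p_m m delta0 / p_m m delta1|
                        / (m%:R * Num.sqrt 8)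
                      - Num.sqrt (ln (2 / alpha))) 0) ^+ 2))%:E)%E &
      gamma < 1 / 2 ->
        exists2 e : nat -> R, e n @[n --> \oo] --> (0 : R) &
          \forall n \near \oo,
            (((1 + e n) * (1 - alpha))%:E
               <= P1 n [set w | test m delta0 alpha (G n m w) = 0%N])%E].
Proof.
have delta_alt_gt n t : - m%:R < delta_alt delta0 delta1 c gamma n t.
  by rewrite /delta_alt; case: ifP.
have meas n (Q : pred 'M[nat]_n.+1) : (0 < n)%N ->
    measurable [set w | Q (G n m w)].
  by apply: (measurable_graph_event Q v_meas G_proc P0_law).
have rejE n : [set w | test m delta0 alpha (G n m w) <> 0%N]
    = [set w | test m delta0 alpha (G n m w) != 0%N].
  by apply/seteqP; split=> w /= /eqP.
have accE n : [set w | test m delta0 alpha (G n m w) = 0%N]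
    = [set w | test m delta0 alpha (G n m w) == 0%N].
  by apply/seteqP; split=> w /= /eqP.
have rejM n : (0 < n)%N ->
    measurable [set w | test m delta0 alpha (G n m w) != 0%N].
  exact: (meas n (fun A => test m delta0 alpha A != 0%N)).
have accM n : (0 < n)%N ->
    measurable [set w | test m delta0 alpha (G n m w) == 0%N].
  exact: (meas n (fun A => test m delta0 alpha A == 0%N)).
have m0 : 0 < m%:R :> R by rewrite ltr0n.
have m1 : 1 <= m%:R :> R by rewrite ler1n.
set rho := 1 - p_m m delta0 / p_m m delta1.
have rho0 : 0 < `|rho|.
  rewrite normr_gt0 subr_eq0 eq_sym; apply: contra delta01 => /eqP h.
  apply/eqP/(p_m_inj m_ge1 delta0_gt delta1_gt).
  by rewrite -[RHS]mul1r -h divfK// gt_eqF// p_m_gt0.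
have crho0 : 0 < c * `|rho| by rewrite mulr_gt0.
have s8 : 0 < Num.sqrt 8 :> R by rewrite sqrtr_gt0.
pose sL := Num.sqrt (ln (2 / alpha)).
have sL0 : 0 < sL by rewrite sqrtr_gt0 ln_level_gt0.
have sE (n : nat) : Num.sqrt n%:R = n%:R `^ (1 / 2) :> R.
  by rewrite div1r powR12_sqrt.
split.
- exists (fun=> 0); first exact: cvg_cst.
  near=> n; have n0 : (0 < n)%N by near: n; exists 1%N.
  rewrite addr0 mul1r rejE (prE _ (rejM n n0)) lee_fin.
  apply: (pr_reject_le m_ge1 v_meas G_proc P0_law _ n0 alpha01) => //.
    by near: n; exact: near_threshold_le.
  by near: n; exact: near_null_bias.
- move=> gamma2; exists (fun n =>
    pr (P1 n) [set w | test m delta0 alpha (G n m w) == 0%N]); last first.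
    near=> n; have n0 : (0 < n)%N by near: n; exists 1%N.
    by rewrite accE (prE _ (accM n n0)).
  apply/cvgr0Pnorm_lt => eps eps0.
  (* Chosen so that deviations of size [M * sqrt n] have exponent [2 * m * (1 + 2 / eps) ^+ 2];
     already [1 + z <= expR z] then brings the tail below [eps]. *)
  pose M := 2 * m%:R * (1 + 2 / eps).
  have e2 : 0 < 2 / eps by rewrite divr_gt0.
  have M0 : 0 < M by rewrite !mulr_gt0//; lra.
  near=> n.
  have n0 : (0 < n)%N by near: n; exists 1%N.
  rewrite ger0_norm ?pr_ge0//.
  set s := Num.sqrt (n%:R : R).
  have s1 : 2 * M <= s by rewrite /s; near: n; exact: near_le_sqrt.
  have s0 : 0 < s by lra.
  have ssE : s ^+ 2 = n%:R by rewrite sqr_sqrtr.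
  set g : R := n%:R `^ gamma.
  (* The bias keeps at least half of its leading term, which outgrows every multiple of [sqrt n]. *)
  have hb : `|mean_deg m (delta_alt delta0 delta1 c gamma n) n.-1
      - n%:R * p_m m delta0 - c * g * rho| <= c * `|rho| / 2 * g.
    by rewrite /g; near: n; apply: near_alt_bias => //; rewrite divr_gt0.
  have hg : (M + m%:R * Num.sqrt 8 * sL) / (c * `|rho| / 2) * s <= g.
    by rewrite /s (sE n) /g; near: n; exact: near_powR_le.
  have g0 : 0 <= g by exact: powR_ge0.
  apply: le_lt_trans (pr_accept_le (y := M * s) m_ge1 v_meas G_proc (P1_law n)
    _ n0 _ _) _ => //.
  + rewrite mulr_ge0 ?(ltW M0) ?(ltW s0)//= natrM -ssE.
    have : M * s * 2 <= s * s by rewrite mulrAC ler_wpM2r ?(ltW s0)//; lra.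
    have : s * s <= m%:R * (s * s) by rewrite ler_peMl// mulr_ge0// ltW.
    by rewrite expr2; lra.
  + rewrite thresholdE// -/s -/sL -mulrDl.
    move: hg; rewrite mulrAC ler_pdivrMr; last by rewrite divr_gt0.
    move=> /le_trans; apply; move: hb.
    set b := _ - n%:R * _ => hb.
    have := lerB_dist (c * g * rho) b.
    rewrite distrC (_ : `|c * g * rho| = c * g * `|rho|); first lra.
    by rewrite !normrM (ger0_norm g0) (gtr0_norm c_gt0).
  have -> : (M * s) ^+ 2 / (2 * (m * n)%:R) = 2 * m%:R * (1 + 2 / eps) ^+ 2.
    by rewrite exprMn ssE natrM /M; field; rewrite !gt_eqF// ltr0n.
  rewrite expRN ltr_pdivrMr ?expR_gt0//.
  have h : 1 + 2 * m%:R * (1 + 2 / eps) ^+ 2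
      <= expR (2 * m%:R * (1 + 2 / eps) ^+ 2) by exact: expR_ge1Dx.
  rewrite mulrC -ltr_pdivrMr//; apply: lt_le_trans h.
  have : 1 + 2 / eps <= (1 + 2 / eps) ^+ 2 by rewrite expr2 ler_peMl//; lra.
  have : (1 + 2 / eps) ^+ 2 <= m%:R * (1 + 2 / eps) ^+ 2.
    by rewrite ler_peMl// sqr_ge0.
  lra.
- move=> gammaE; exists (fun=> 0); first exact: cvg_cst.
  rewrite addr0; set x := _ - Num.sqrt (ln _).
  (* If the maximum is 0, the claimed bound is 2 and exceeds any probability. *)
  case: (leP x 0) => [x0|x0].
    near=> n; have n0 : (0 < n)%N by near: n; exists 1%N.
    rewrite accE expr0n oppr0 expR0 mulr1.
    apply: le_trans (probability_le1 _ (accM n n0)) _.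
    by rewrite lee_fin ler1n.
  have ms8 : 0 < m%:R * Num.sqrt 8 :> R by rewrite mulr_gt0.
  (* The leading bias exceeds the threshold by [2 * y * sqrt n]. One share pays for the error on the
     mean, the other for fluctuations, whose exponent [m * x ^+ 2] is at least [x ^+ 2]. *)
  pose y := m%:R * Num.sqrt 8 * x / 2.
  have y0 : 0 < y by rewrite /y divr_gt0// mulr_gt0.
  near=> n; have n0 : (0 < n)%N by near: n; exists 1%N.
  rewrite accE (prE _ (accM n n0)) lee_fin.
  set s := Num.sqrt (n%:R : R).
  have s1 : 2 * y <= s by rewrite /s; near: n; exact: near_le_sqrt.
  have s0 : 0 < s by lra.
  have ssE : s ^+ 2 = n%:R by rewrite sqr_sqrtr.
  have hb : `|mean_deg m (delta_alt delta0 delta1 c gamma n) n.-1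
      - n%:R * p_m m delta0 - c * n%:R `^ gamma * rho| <= y * n%:R `^ gamma.
    by near: n; apply: near_alt_bias.
  rewrite [n%:R `^ gamma](_ : _ = s) in hb; last by rewrite /s (sE n) gammaE.
  apply: le_trans (pr_accept_le (y := y * s) m_ge1 v_meas G_proc (P1_law n)
    _ n0 _ _) _ => //.
  + rewrite mulr_ge0 ?(ltW y0) ?(ltW s0)//= natrM -ssE.
    have : y * s * 2 <= s * s by rewrite mulrAC ler_wpM2r ?(ltW s0)//; lra.
    have : s * s <= m%:R * (s * s) by rewrite ler_peMl// mulr_ge0// ltW.
    by rewrite expr2; lra.
  + rewrite thresholdE// -/s -/sL; move: hb; set b := _ - n%:R * _ => hb.
    have := lerB_dist (c * s * rho) b.
    rewrite distrC (_ : `|c * s * rho| = (c * `|rho|) * s); last first.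
      by rewrite !normrM (gtr0_norm s0) (gtr0_norm c_gt0) mulrAC.
    have -> : c * `|rho| = 2 * y + m%:R * Num.sqrt 8 * sL.
      by rewrite /y /x -/sL; field; rewrite !gt_eqF.
    lra.
  rewrite ler_wpM2l// ler_expR lerN2.
  have -> : (y * s) ^+ 2 / (2 * (m * n)%:R) = m%:R * x ^+ 2.
    rewrite !exprMn ssE natrM sqr_sqrtr//.
    by field; rewrite !gt_eqF// ltr0n.
  by rewrite ler_peMl// sqr_ge0.
- move=> gamma2; exists (fun=> 0); first exact: cvg_cst.
  near=> n; have n0 : (0 < n)%N by near: n; exists 1%N.
  rewrite addr0 mul1r accE (prE _ (accM n n0)) lee_fin.
  rewrite [X in pr _ X](_ : _ = ~` [set w | test m delta0 alpha (G n m w) != 0%N]).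
    rewrite (pr_setC _ (rejM n n0)) lerD2l lerN2.
    apply: (pr_reject_le m_ge1 v_meas G_proc (P1_law n) _ n0 alpha01) => //.
      by near: n; exact: near_threshold_le.
    set g : R := n%:R `^ gamma.
    have hb : `|mean_deg m (delta_alt delta0 delta1 c gamma n) n.-1
        - n%:R * p_m m delta0 - c * g * rho| <= 1 * g.
      by rewrite /g; near: n; apply: near_alt_bias.
    rewrite thresholdE// -/sL.
    (* Here [n^gamma] is negligible against [sqrt n], so the whole bias fits in half of the
       threshold. *)
    have hg : (c * `|rho| + 1) / (m%:R * Num.sqrt 8 * sL / 2) * g
        <= Num.sqrt n%:R.
      by rewrite (sE n) /g; near: n; exact: near_powR_le.
    move: hg; rewrite mulrAC ler_pdivrMr; last by rewrite divr_gt0// !mulr_gt0.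
    have g0 : 0 <= g by exact: powR_ge0.
    move: hb; set b := _ - n%:R * _ => hb.
    have := ler_normD (b - c * g * rho) (c * g * rho).
    rewrite subrK (_ : `|c * g * rho| = c * g * `|rho|); first lra.
    by rewrite !normrM (ger0_norm g0) (gtr0_norm c_gt0).
  by apply/seteqP; split=> w /=; [move=> H; apply/negP|move/negP]; rewrite negbK.
Unshelve. all: by end_near. Qed.
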